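(* Let $n\ge 2$ and let $\mathcal{D}\subseteq\binom{[n]}{2}$ be such that $\mathcal{D}^c$ is a nonempty positroid, with associated graph $G_{\mathcal{D}}$. Let $C_1,\dots,C_m$ be the connected components of $G_{\mathcal{D}}$, cyclically ordered (with $C_{m+1}=C_1$). Let $$J=\{j\in[n]\setminus T_{\mathcal{D}} : j\in V(C_i)\text{ for some } i\in[m] \text{ with } |V(C_i)|>1\}.$$ Then the set of all nonempty positroids $\mathcal{P}$ such that $\mathcal{P}\subset\mathcal{D}^c$ and $\dim\mathcal{P}=\dim(\mathcal{D}^c)-1$ is exactly the set of nonempty collections among the complements $\mathcal{E}^c$ of the members $\mathcal{E}$ of $$\partial\mathrm{Pos}_1(\mathcal{D})=\{\mathcal{D}\cup(C_i\cdot C_{i+1}) : i\in[m]\}\ \cup\ \bigcup_{j\in J}\{\mathcal{D}+\{j\}\}.$$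
   Context: $[n]=\{1,\dots,n\}$ is cyclically ordered, $\binom{[n]}{2}$ is the set of 2-element subsets of $[n]$, and complements $(\cdot)^c$ are taken in $\binom{[n]}{2}$. $\mathrm{Gr}_{\ge0}(2,n)$ is the set of 2-dimensional subspaces of $\mathbb{R}^n$ that are row spans of real $2\times n$ matrices all of whose maximal minors (columns in increasing order) are nonnegative. For nonempty $\mathcal{I}\subseteq\binom{[n]}{2}$, $S_+(\mathcal{I})\subseteq\mathrm{Gr}_{\ge0}(2,n)$ is the set of points represented by a real $2\times n$ matrix $A$ such that, for $I=\{i<j\}$, the minor $\det A[I]$ is $>0$ if $I\in\mathcal{I}$ and $=0$ otherwise. $\mathcal{I}$ is a positroid if $S_+(\mathcal{I})\neq\emptyset$; then $S_+(\mathcal{I})$ is a topological cell and $\dim\mathcal{I}$ denotes its dimension. $T_{\mathcal{D}}=\{i\in[n] : \{i,j\}\in\mathcal{D}\text{ for all }j\in[n]\setminus\{i\}\}$; $G_{\mathcal{D}}$ is the simple graph with vertex set $[n]\setminus T_{\mathcal{D}}$ and edge set $\{\{i,j\}\in\mathcal{D} : i,j\notin T_{\mathcal{D}}\}$. When $\mathcal{D}^c$ is a positroid, the components of $G_{\mathcal{D}}$ are complete graphs whose vertex sets are cyclic intervals of $[n]\setminus T_{\mathcal{D}}$; ''cyclically ordered'' means that for every $i\in[m]$ there is an element of $V(C_i)$ whose cyclic successor in $[n]\setminus T_{\mathcal{D}}$ lies in $V(C_{i+1})$. $C_i\cdot C_{i+1}=\{\{a,b\} : a\in V(C_i),\ b\in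 V(C_{i+1})\}$, and $\mathcal{D}+\{j\}=\mathcal{D}\cup\{\{j,l\} : l\in[n]\setminus\{j\}\}$. *)

(* Defs.v *)
From HB Require Import structures.
From mathcomp Require Import all_boot all_order all_algebra.
From mathcomp Require Import all_classical all_reals all_analysis.

Set Implicit Arguments.
Unset Strict Implicit.
Unset Printing Implicit Defensive.

Import Order.TTheory GRing.Theory Num.Theory.
Import numFieldNormedType.Exports.

Local Open Scope classical_set_scope.
Local Open Scope ring_scope.

(* The ground set [n] = {1, ..., n} is 'I_n = {0, ..., n-1}. *)

Section Grassmannian.
Variables (R : realType) (n : nat).

Definition rowspan (A : 'M[R]_(2, n)) : {vspace 'rV[R]_n} :=
  <<[seq row i A | i : 'I_2]>>%VS.

Definition frame_set : set 'M[R]_(2, n) := [set A | \dim (rowspan A) == 2%N].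

(* The space of 2 x n matrices of rank 2, with the subspace topology. *)
Definition frame : topologicalType := set_type frame_set.

Definition Gr2 : Type := {V : {vspace 'rV[R]_n} | \dim V == 2%N}.

HB.instance Definition _ := Choice.on Gr2.

Definition Gr2_of_frame (A : frame) : Gr2 :=
  exist _ (rowspan (set_val A)) (set_valP A).

(* Gr(2,n) carries the quotient topology of the surjection Gr2_of_frame. *)
Definition Gr2_open (U : set Gr2) : Prop := open (Gr2_of_frame @^-1` U).

Fact Gr2_openT : Gr2_open setT.
Proof. by rewrite /Gr2_open preimage_setT; exact: openT. Qed.

Fact Gr2_openI : setI_closed Gr2_open.
Proof. by move=> U V oU oV; rewrite /Gr2_open preimage_setI; exact: openI. Qed.

Fact Gr2_open_bigU (I : Type) (f : I -> set Gr2) :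
  (forall i, Gr2_open (f i)) -> Gr2_open (\bigcup_i f i).
Proof.
by move=> of_; rewrite /Gr2_open preimage_bigcup; apply: bigcup_open => i _; exact: of_.
Qed.

HB.instance Definition _ :=
  isOpenTopological.Build Gr2 Gr2_openT Gr2_openI Gr2_open_bigU.

(* The maximal minor on the columns i and j, in this order. *)
Definition minor2 (A : 'M[R]_(2, n)) (i j : 'I_n) : R :=
  \det (colsub (tnth [tuple i; j]) A).

Definition Gr2_nneg : set Gr2 :=
  [set V | exists2 A : 'M[R]_(2, n), rowspan A = sval V &
           forall i j : 'I_n, (i < j)%N -> 0 <= minor2 A i j].

Definition positroid_cell (I : {set {set 'I_n}}) : set Gr2 :=
  Gr2_nneg `&`
  [set V | exists2 A : 'M[R]_(2, n), rowspan A = sval V &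
           forall i j : 'I_n, (i < j)%N ->
             if [set i; j]%SET \in I then 0 < minor2 A i j
             else minor2 A i j == 0].

End Grassmannian.

Arguments frame_set : clear implicits.
Arguments Gr2_nneg : clear implicits.
Arguments positroid_cell R {n} I.

Definition homeomorphic (T U : topologicalType) : Prop :=
  exists (f : T -> U) (g : U -> T),
    [/\ cancel f g, cancel g f, continuous f & continuous g].

Section Positroids.
Variables (R : realType) (n : nat).

Definition pairs : {set {set 'I_n}} := [set I : {set 'I_n} | #|I| == 2%N]%SET.

Definition pairsC (D : {set {set 'I_n}}) : {set {set 'I_n}} := pairs :\: D.

Definition positroid (I : {set {set 'I_n}}) : Prop :=
  [/\ I \subset pairs, I != finset.set0 & positroid_cell R I !=set0].

(* The dimension of the topological cell S_+(I), that is, the d such that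
   S_+(I) is homeomorphic to R^d.  The default value 0 of xget is only used
   when no such d exists; this does not happen for a positroid. *)
Definition positroid_dim (I : {set {set 'I_n}}) : nat :=
  xget 0%N [set d | homeomorphic (set_type (positroid_cell R I)) 'rV[R]_d].

End Positroids.

Section GraphOfPairs.
Variables (n : nat) (D : {set {set 'I_n}}).

Definition full_vertices : {set 'I_n} :=
  [set i | [forall (j | j != i), [set i; j]%SET \in D]]%SET.

Definition graph_vertices : {set 'I_n} := (~: full_vertices)%SET.

Definition graph_edge : rel 'I_n :=
  [rel i j | [&& i \in graph_vertices, j \in graph_vertices, i != j
               & [set i; j]%SET \in D]].

(* The set of the vertex sets V(C) of the connected components C of G_D. *)
Definition components : {set {set 'I_n}} :=
  equivalence_partition (connect graph_edge) graph_vertices.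

(* The cyclic successor in [n] \ T_D: enum lists a subset of 'I_n in
   increasing order, and next reads this list cyclically. *)
Definition cyclic_succ (a : 'I_n) : 'I_n := next (enum graph_vertices) a.

(* C_1, ..., C_m lists the components without repetition, in cyclic order;
   ordS is the cyclic successor in 'I_m, so that C_{m+1} = C_1. *)
Definition cyclically_ordered_components (m : nat) (C : 'I_m -> {set 'I_n}) :
    Prop :=
  [/\ injective C,
      [set C i | i : 'I_m]%SET = components &
      forall i : 'I_m, exists2 a, a \in C i & cyclic_succ a \in C (ordS i)].

Definition cross_pairs (A B : {set 'I_n}) : {set {set 'I_n}} :=
  [set [set a; b]%SET | a in A, b in B]%SET.

Definition add_full (j : 'I_n) : {set {set 'I_n}} :=
  (D :|: [set [set j; l]%SET | l in [set~ j]])%SET.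

Definition nonsingleton_vertices (m : nat) (C : 'I_m -> {set 'I_n}) :
    {set 'I_n} :=
  [set j in graph_vertices |
    [exists i : 'I_m, (j \in C i) && (1 < #|C i|)%N]]%SET.

Definition boundary1 (m : nat) (C : 'I_m -> {set 'I_n}) : {set {set {set 'I_n}}} :=
  ([set D :|: cross_pairs (C i) (C (ordS i)) | i : 'I_m]
   :|: [set add_full j | j in nonsingleton_vertices C])%SET.

End GraphOfPairs.

(* Main.v *)
Require Import Defs.
From mathcomp Require Import all_boot all_order all_fingroup all_algebra.
From mathcomp Require Import all_classical all_reals all_analysis.
From mathcomp Require Import zify ring lra.

(* In a positroid of rank 2 the nonloops fall into parallel classes.  Normalizing
   two nonparallel columns to the standard basis identifies the cell with the space
   of positive scales of the remaining k - 2 nonloops and of increasing slopes of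
   the remaining c - 2 classes, so its dimension is k + c - 4.  This number can be
   read off the topology because real vector spaces of different dimensions are not
   homeomorphic: colouring R^m by m + 1 families of small separated bricks and
   pulling back along an embedding of a cube of dimension n > m contradicts the
   discrete Poincaré-Miranda theorem, which is proved by Stokes' theorem on Kuhn's
   triangulation of the grid.
   A smaller positroid has fewer nonloops and coarser classes, so k + c drops by one
   only if one nonloop in a class of size > 1 becomes a loop, or two classes merge.
   Positivity of the minors forces merged classes to be cyclically adjacent, and
   adjacent classes can be merged by turning one onto the direction of the other. *)

Set Implicit Arguments.
Unset Strict Implicit.
Unset Printing Implicit Defensive.
Import Order.TTheory GRing.Theory Num.Theory.
Import numFieldNormedType.Exports.
Local Open Scope ring_scope.


(** * A discrete Poincaré-Miranda theorem *)

(** The dimension is defined by choosing some homeomorphism, so no count can enter before invariance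
    of dimension is known. The argument for it stays finite: the degree of a labelling is a sum of
    integer determinants, and only uniform continuity on a cube ties it to the map. The Grassmannian
    is a quotient space; the chart is continuous because its coordinates are built from ratios of
    minors, which depend on the row span only. Turning a nonloop that is alone in its class into a
    loop lowers both k and c, which is why J keeps only components with more than one vertex.
    Merging when there are only two classes leaves no pair at all; this is where the restriction to
    nonempty collections enters. Merging across the end of the linear order requires a change of
    sign: in rank 2 a column moved from one end to the other must be negated to keep the minors
    nonnegative. *)

Lemma det_scaled_row (R : comPzRingType) n (A : 'M[R]_n) i1 i2 (c : R) :
  i1 != i2 -> (forall j, A i1 j = c * A i2 j) -> \det A = 0.
Proof.
move=> ne e; pose B := \matrix_(i, j) (if i == i1 then A i2 j else A i j).
rewrite (@determinant_multilinear _ _ A B B i1 c 0).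
- rewrite mul0r addr0 (@determinant_alternate _ _ B i1 i2) ?mulr0 // => j.
  by rewrite !mxE eqxx eq_sym (negbTE ne).
- by apply/rowP => j; rewrite !mxE eqxx mul0r addr0.
- by apply/matrixP => i j; rewrite !mxE eq_sym (negbTE (neq_lift _ _)).
- by apply/matrixP => i j; rewrite !mxE eq_sym (negbTE (neq_lift _ _)).
Qed.

Section KuhnTriangulation.
Variables (p N : nat).
Local Notation n := p.+1.
Local Notation lattice_pt := {ffun 'I_n -> nat}.

(** The vertex of Kuhn's simplex reached after [j] unit steps from [x]; coordinate [i] is raised at
    step [s i], counted from 0. *)
Definition kuhn_vertex (x : lattice_pt) (s : 'S_n) (j : nat) : lattice_pt :=
  [ffun i => (x i + (s i < j))%N].

Definition kuhn_mx (f : 'I_n.+1 -> lattice_pt -> int) (w : nat -> lattice_pt) : 'M[int]_n.+1 :=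
  \matrix_(i, j) f i (w j).

Definition base_point (x : {ffun 'I_n -> 'I_N.+1}) : lattice_pt := [ffun i => x i : nat].

Definition inner (x : {ffun 'I_n -> 'I_N.+1}) := [forall i, (x i < N)%N].

(** When [f ord0] is constantly 1, this is [n!] times the signed volume swept by the piecewise
    linear map whose coordinates are the other rows. *)
Definition kuhn_sum (f : 'I_n.+1 -> lattice_pt -> int) : int :=
  \sum_(x | inner x) \sum_(s : 'S_n)
    (-1) ^+ s * \det (kuhn_mx f (kuhn_vertex (base_point x) s)).

(** Up to a constant factor, the integral over one face of [f k] times the product of the
    differentials of the other nonconstant rows. *)
Definition face_form (f : 'I_n.+1 -> lattice_pt -> int) (k : 'I_n.+1) (w : 'I_n -> lattice_pt) : int :=
  (\sum_l f k (w l)) * \det (\matrix_(i < n, l < n) f (lift k i) (w l)).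

Lemma eq_face_form f k w w' : w =1 w' -> face_form f k w = face_form f k w'.
Proof.
move=> e; rewrite /face_form; rewrite (eq_bigr (fun l => f k (w' l))); last by move=> l _; rewrite e.
by congr (_ * determinant _); apply/matrixP => i j; rewrite !mxE e.
Qed.

(* Adding multiples of the constant row [f ord0] to row [k] turns the
   expansion along row [k] into a sum of terms depending on one face each. *)
Lemma det_kuhn_face f (k : 'I_n) w : (forall z, f ord0 z = 1) ->
  let k' := lift ord0 k in
  \det (kuhn_mx f w) =
  - (-1) ^+ k' * \sum_(j < n.+1) (-1) ^+ j * face_form f k' (fun l => w (lift j l)).
Proof.
move=> f0 k'.
set M := kuhn_mx f w.
have E1 : \sum_j cofactor M k' j = 0.
  pose M1 := \matrix_(i, j) (if i == k' then 1 else M i j).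
  have D : \det M1 = 0.
    apply: (@determinant_alternate _ _ _ ord0 k') => // j.
    by rewrite !mxE eqxx /= f0.
  rewrite -[RHS]D (expand_det_row M1 k'); apply: eq_bigr => j _.
  rewrite mxE eqxx mul1r /cofactor; congr (_ * determinant _).
  by apply/matrixP => a b; rewrite !mxE eq_sym (negbTE (neq_lift _ _)).
rewrite (expand_det_row M k').
pose S := \sum_j f k' (w (j : 'I_n.+1)).
have -> : \sum_j M k' j * cofactor M k' j =
   - \sum_j (S - M k' j) * cofactor M k' j.
  apply/eqP; rewrite -addr_eq0 -big_split /=.
  rewrite (eq_bigr (fun j => S * cofactor M k' j)) => [|j _].
    by rewrite -mulr_sumr E1 mulr0.
  by rewrite -mulrDl addrC subrK.
rewrite mulNr mulr_sumr; congr (- _); apply: eq_bigr => j _.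
rewrite /face_form /cofactor mulrA exprD.
have -> : S - M k' j = \sum_(l < n) f k' (w (lift j l)).
  by rewrite /S (bigD1_ord j) //= mxE addrAC subrr add0r.
have -> : row' k' (col' j M) = \matrix_(i < n, l < n) f (lift k' i) (w (lift j l)).
  by apply/matrixP => a b; rewrite !mxE.
by ring.
Qed.

Lemma tperm_ltn (a b : 'I_n) (c : nat) : b = a.+1 :> nat -> c != b ->
  forall i, (tperm a b i < c)%N = (i < c)%N.
Proof. by move=> ab cb i; case: tpermP => [->|->|]//; lia. Qed.

(** Exchanging the steps [j.-1] and [j] moves only the vertex that this face omits, so the face
    belongs to two simplices of the same cube with opposite signs. *)
Lemma kuhn_interior_face f (k : 'I_n.+1) x (j : 'I_n.+1) : (0 < j < n)%N ->
  \sum_(s : 'S_n) (-1) ^+ s *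
     face_form f k (fun l => kuhn_vertex x s (lift j l)) = 0.
Proof.
move=> /andP[j0 jn].
have ja : (j.-1 < n)%N by lia.
pose a := Ordinal ja; pose b := Ordinal jn.
have ab : a != b by rewrite -val_eqE /=; lia.
set S := LHS.
have : S = - S.
  rewrite {1}/S (reindex_inj (mulIg (tperm a b))) /S -sumrN /=.
  apply: eq_bigr => s _; rewrite odd_permM odd_tperm ab addbT signrN mulNr.
  congr (- (_ * _)); apply: eq_face_form => l; apply/ffunP => i; rewrite !ffunE permM.
  by rewrite tperm_ltn //=; rewrite /bump; lia.
by move=> /eqP; rewrite -addr_eq0 -mulr2n mulrn_eq0 => /eqP.
Qed.

(** The cycle [0 -> p], [i -> i.-1]: the first step of a path is dropped and appended at the end. *)
Definition rot_perm : 'S_n := lift_perm ord0 ord_max 1.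

Lemma rot_permE (i : 'I_n) : rot_perm i = (if i == 0%N :> nat then p else i.-1) :> nat.
Proof.
rewrite /rot_perm; case: (unliftP ord0 i) => [j ->|->]; last by rewrite lift_perm_id.
by rewrite lift_perm_lift perm1 lift_max lift0.
Qed.

Lemma odd_rot_perm : rot_perm = odd p :> bool.
Proof. by rewrite odd_lift_perm /= odd_perm1 addbF. Qed.

(* The face opposite to the first vertex of a simplex is the face opposite to
   the last vertex of a simplex of the cube shifted in direction [s^-1 0]. *)
Lemma kuhn_first_face x (s : 'S_n) (l : 'I_n) :
  kuhn_vertex x s (lift ord0 l) =
  kuhn_vertex [ffun i => (x i + (i == s^-1%g ord0))%N] (s * rot_perm) (lift ord_max l).
Proof.
apply/ffunP => i; rewrite !ffunE permM rot_permE lift0 lift_max -addnA; congr addn.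
have -> : (i == s^-1%g ord0) = (s i == ord0) by rewrite (canF_eq (permK s)).
have := ltn_ord l; have -> : (s i == ord0) = (s i == 0%N :> nat) by [].
by case: eqP => ?; lia.
Qed.


(** Layers strictly inside the grid occur in both sums, and the two extreme layers contribute
    nothing. *)
Lemma sum_shift (G : lattice_pt -> int) (i0 : 'I_n) :
  (forall z : lattice_pt, (forall i, (z i + (i != i0) <= N)%N) -> (z i0 == 0%N) || (z i0 == N) -> G z = 0) ->
  \sum_(x | inner x) G [ffun i => (base_point x i + (i == i0))%N] =
  \sum_(x | inner x) G (base_point x).
Proof.
move=> G0.
(* The shift is made cyclic on ['I_N.+1], so that it is a bijection; [inner] excludes the layer that
   wraps. *)
pose sh (x : {ffun 'I_n -> 'I_N.+1}) := [ffun i => if i == i0 then ordS (x i) else x i].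
pose hs (x : {ffun 'I_n -> 'I_N.+1}) := [ffun i => if i == i0 then ord_pred (x i) else x i].
have shK : cancel sh hs.
  by move=> x; apply/ffunP => i; rewrite !ffunE; case: eqP => // _; rewrite ordSK.
have hsK : cancel hs sh.
  by move=> x; apply/ffunP => i; rewrite !ffunE; case: eqP => // _; rewrite ord_predK.
pose Q (x : {ffun 'I_n -> 'I_N.+1}) := [forall i, (i != i0) ==> (x i < N)%N].
have innerE x : inner x = Q x && (x i0 != N :> nat).
  apply/forallP/andP => [H|[/forallP H1 H2] i].
    by split; [apply/forallP => i; rewrite H implybT | rewrite neq_ltn H].
  case: (eqVneq i i0) => [->|ii0]; last by have := H1 i; rewrite ii0.
  by have := ltn_ord (x i0); lia.
have leN x : Q x -> forall i, (base_point x i + (i != i0) <= N)%N.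
  move=> /forallP Qx i; have := Qx i; rewrite ffunE.
  by case: eqP => _ /=; have := ltn_ord (x i); lia.
transitivity (\sum_(x | Q x && (x i0 != 0%N :> nat)) G (base_point x)).
  rewrite [RHS](reindex_onto sh hs) /=; last by move=> x _; rewrite hsK.
  apply: eq_big => [x|x].
    rewrite innerE shK eqxx andbT; congr (_ && _).
      by apply: eq_forallb => i; rewrite ffunE; case: eqVneq.
    rewrite ffunE eqxx /=; have := ltn_ord (x i0).
    case: (eqVneq (x i0 : nat) N) => [->|ne lt]; first by rewrite modnn.
    by rewrite modn_small //; lia.
  rewrite innerE => /andP[_ ne]; congr G; apply/ffunP => i; rewrite !ffunE.
  case: eqP => [->|] /=; last by rewrite addn0.
  by rewrite modn_small ?addn1 //; have := ltn_ord (x i0); lia.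
rewrite [LHS]big_mkcondr [RHS](eq_bigl _ _ innerE) [RHS]big_mkcondr /=.
apply: eq_bigr => x /leN Qx; case: ifPn => [_|]; case: ifPn => //.
- by rewrite negbK => /eqP e; rewrite G0 // !ffunE e eqxx orbT.
- by rewrite negbK => _ /eqP e; rewrite G0 // !ffunE e eqxx.
Qed.

Definition grid (z : lattice_pt) := [forall i, (z i <= N)%N].

(** Faces inside a cube cancel in pairs, faces shared by two cubes cancel by [sum_shift], and the
    hypotheses kill the faces on the boundary of the grid. *)
Lemma kuhn_stokes f (k : 'I_n) : (forall z, f ord0 z = 1) ->
  (forall z, grid z -> (z k == 0%N) || (z k == N) -> f (lift ord0 k) z = 0) ->
  (forall (i : 'I_n) (c : nat), i != k -> (c == 0%N) || (c == N) ->
     exists b, forall z, grid z -> z i = c -> f (lift ord0 i) z = b) ->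
  kuhn_sum f = 0.
Proof.
move=> f0 fk fi; rewrite /kuhn_sum.
pose k' := lift ord0 k.
pose F (x : lattice_pt) (s : 'S_n) (j : 'I_n.+1) := face_form f k' (fun l => kuhn_vertex x s (lift j l)).
rewrite (eq_bigr (fun x => - (-1) ^+ k' *
   \sum_(j < n.+1) (-1) ^+ j * \sum_(s : 'S_n) (-1) ^+ s * F (base_point x) s j)); last first.
  move=> x _; rewrite (eq_bigr (fun s : 'S_n => - (-1) ^+ k' *
     \sum_(j < n.+1) (-1) ^+ s * ((-1) ^+ j * F (base_point x) s j))); last first.
    by move=> s _; rewrite (det_kuhn_face k) // -mulr_sumr mulrCA.
  rewrite -mulr_sumr exchange_big /=; congr (_ * _); apply: eq_bigr => j _.
  by rewrite mulr_sumr; apply: eq_bigr => s _; rewrite mulrCA.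
rewrite -mulr_sumr; apply/eqP; rewrite mulf_eq0; apply/orP; right; apply/eqP.
rewrite (eq_bigr (fun x => \sum_(s : 'S_n) (-1) ^+ s * F (base_point x) s ord0
   + (-1) ^+ n * \sum_(s : 'S_n) (-1) ^+ s * F (base_point x) s ord_max)); last first.
  move=> x _; rewrite big_ord_recl big_ord_recr /= expr0 mul1r; congr (_ + _).
  rewrite [X in X + _]big1 ?add0r; last first.
    move=> j _; rewrite /F kuhn_interior_face ?mulr0 //.
    by rewrite lift0 /=; have := ltn_ord j; lia.
  have -> : lift ord0 (@ord_max p) = @ord_max n by apply: val_inj.
  by [].
rewrite big_split /= -mulr_sumr exchange_big [X in _ + _ * X]exchange_big /=.
rewrite [X in _ + _ * X](reindex_inj (mulIg rot_perm)) /= mulr_sumr -big_split /=.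
apply: big1 => s _; rewrite -!mulr_sumr.
pose G x := F x (s * rot_perm)%g ord_max.
rewrite (eq_bigr (fun x => G [ffun i => (base_point x i + (i == s^-1%g ord0))%N])); last first.
  by move=> x _; apply: eq_face_form => l; rewrite kuhn_first_face.
rewrite sum_shift => [|z zN zi]; last first.
  set i0 := s^-1%g ord0 in zi.
  have vi0 (l : 'I_n) : kuhn_vertex z (s * rot_perm) (lift ord_max l) i0 = z i0.
    rewrite ffunE permM rot_permE permKV lift_max /=.
    by have := ltn_ord l; lia.
  have vgrid (l : 'I_n) : grid (kuhn_vertex z (s * rot_perm) (lift ord_max l)).
    apply/forallP => i; case: (eqVneq i i0) => [->|ii0]; first by rewrite vi0; have := zN i0; lia.
    by rewrite !ffunE; have := zN i; rewrite ii0; case: (_ < _)%N; lia.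
  rewrite /G /F /face_form.
  (* On a boundary face normal to [k] the factor [f k'] vanishes; on one normal to another direction
     a row of the minor is constant, hence proportional to the row of ones. *)
  case: (eqVneq i0 k) => [ik|/[dup] ik /fi /(_ zi) [b fb]].
    by rewrite big1 ?mul0r // => l _; apply: fk; rewrite // -ik vi0.
  have [q iq|e] := unliftP k' (lift ord0 i0); last first.
    by case/eqP: ik; apply: (lift_inj e).
  have [q0 iq0|e] := unliftP k' ord0; last by have := neq_lift ord0 k; rewrite -/k' -e eqxx.
  rewrite [\det _](_ : _ = 0) ?mulr0 //.
  have q0q : q != q0 by apply: contraTneq (neq_lift ord0 i0) => e; rewrite iq iq0 e eqxx.
  by apply: (det_scaled_row q0q (c := b)) => l; rewrite !mxE -iq -iq0 f0 mulr1 fb.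
(* The rotation has sign [(-1) ^+ p] and the last face enters with [(-1) ^+ p.+1], so the two
   contributions cancel. *)
rewrite mulrA -mulrDl odd_permM odd_rot_perm signr_addb signr_odd exprS.
by rewrite mulN1r mulNr mulrCA -expr2 sqrr_sign mulr1 subrr mul0r.
Qed.

Definition affine_rows (u : 'I_n -> lattice_pt -> int) (i : 'I_n.+1) (z : lattice_pt) : int :=
  if unlift ord0 i is Some k then u k z else 1.

Lemma affine_rows0 u z : affine_rows u ord0 z = 1.
Proof. by rewrite /affine_rows unlift_none. Qed.

Lemma affine_rows_lift u k z : affine_rows u (lift ord0 k) z = u k z.
Proof. by rewrite /affine_rows liftK. Qed.

Lemma det_affine_rows_const u w (k : 'I_n) (c : int) :
  (forall j : 'I_n.+1, u k (w (j : nat)) = c) -> \det (kuhn_mx (affine_rows u) w) = 0.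
Proof.
move=> uc; have ne : lift ord0 k != ord0 by [].
apply: (det_scaled_row ne (c := c)) => j.
by rewrite !mxE affine_rows0 affine_rows_lift uc mulr1.
Qed.

Definition boundary_values (u : 'I_n -> lattice_pt -> int) := forall k z, grid z ->
  (z k = 0%N -> u k z = 0) /\ (z k = N -> u k z = 1).

(** The sum is linear in row [k], and the difference of two admissible rows vanishes on both faces
    normal to [k], as [kuhn_stokes] requires. Applied row by row, this makes the sum depend on
    boundary values only. *)
Lemma kuhn_sum_replace u v (k : 'I_n) : (0 < N)%N -> boundary_values u -> boundary_values v ->
  (forall i, i != k -> u i =1 v i) ->
  kuhn_sum (affine_rows u) = kuhn_sum (affine_rows v).
Proof.
move=> N0 ub vb uv; pose d i z := if i == k then u i z - v i z else u i z.
suff : kuhn_sum (affine_rows u) - kuhn_sum (affine_rows v) = kuhn_sum (affine_rows d).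
  rewrite (@kuhn_stokes (affine_rows d) k) => [/eqP|z|z zN|i c ik].
  - by rewrite subr_eq0 => /eqP.
  - exact: affine_rows0.
  - rewrite affine_rows_lift /d eqxx.
    have [u0 uN] := ub k z zN; have [v0 vN] := vb k z zN.
    by case/orP => /eqP e; [rewrite (u0 e) (v0 e) | rewrite (uN e) (vN e)]; rewrite subrr.
  - case/orP => /eqP ->; [exists 0 | exists 1] => z zN zi;
      by rewrite affine_rows_lift /d (negbTE ik); apply (ub i z zN).
rewrite /kuhn_sum -sumrB; apply: eq_bigr => x _; rewrite -sumrB; apply: eq_bigr => s _.
rewrite -mulrBr; congr (_ * _); set w := kuhn_vertex _ _.
have := @determinant_multilinear _ _ (kuhn_mx (affine_rows d) w) (kuhn_mx (affine_rows u) w)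
  (kuhn_mx (affine_rows v) w) (lift ord0 k) 1 (-1).
rewrite mul1r mulN1r => -> //.
- by apply/rowP => j; rewrite !mxE !affine_rows_lift /d eqxx mul1r mulN1r.
- apply/matrixP => i j; rewrite !mxE; set i' := lift _ i.
  have : i' != lift ord0 k by rewrite eq_sym neq_lift.
  case: (unliftP ord0 i') => [q ->|-> _]; last by rewrite !affine_rows0.
  by rewrite (inj_eq lift_inj) !affine_rows_lift /d => /negbTE ->.
- apply/matrixP => i j; rewrite !mxE; set i' := lift _ i.
  have : i' != lift ord0 k by rewrite eq_sym neq_lift.
  case: (unliftP ord0 i') => [q ->|-> _]; last by rewrite !affine_rows0.
  by rewrite (inj_eq lift_inj) !affine_rows_lift /d => /[dup] /uv <- /negbTE ->.
Qed.

(** A reference map of degree one under which every cube except the one at the far corner has a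
    degenerate image. *)
Definition top_face (k : 'I_n) (z : lattice_pt) : int := (z k == N)%:R.

Lemma top_face_boundary : (0 < N)%N -> boundary_values top_face.
Proof.
by move=> N0 k z _; rewrite /top_face; split=> ->; rewrite ?eqxx // eq_sym eqn0Ngt N0.
Qed.

Lemma kuhn_sum_top_face : (0 < N)%N -> kuhn_sum (affine_rows top_face) = n`!%:R.
Proof.
move=> N0; rewrite /kuhn_sum.
have lastN : (N.-1 < N.+1)%N by lia.
pose x0 : {ffun 'I_n -> 'I_N.+1} := [ffun=> Ordinal lastN].
rewrite (bigD1 x0) /=; last by apply/forallP => i; rewrite ffunE /=; lia.
rewrite [X in _ + X]big1 ?addr0; last first.
  move=> x /andP[/forallP xN xx0]; apply: big1 => s _.
  have [k xk] : exists k, (x k < N.-1)%N.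
    apply/existsP; apply: contraNT xx0 => /existsPn H.
    by apply/eqP/ffunP => i; apply/val_inj; rewrite ffunE /=; have := H i; have := xN i; lia.
  rewrite (@det_affine_rows_const _ _ k 0) ?mulr0 // => j.
  by rewrite /top_face !ffunE; case: eqP => //; case: (_ < _)%N; lia.
rewrite (eq_bigr (fun=> 1)) => [|s _].
  by rewrite sumr_const card_Sn.
(* In the far cube the matrix is unitriangular up to permuting rows by [s], whose sign cancels the
   orientation sign. *)
pose U : 'M[int]_n.+1 := \matrix_(i, j) (i <= j)%N%:R.
have -> : kuhn_mx (affine_rows top_face) (kuhn_vertex (base_point x0) s) =
    row_perm (lift_perm ord0 ord0 s) U.
  apply/matrixP => i j; rewrite !mxE; case: (unliftP ord0 i) => [k ->|->].
    rewrite affine_rows_lift lift_perm_lift lift0 /top_face !ffunE /=.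
    by case: ltnP => _; congr (nat_of_bool _)%:R; lia.
  by rewrite affine_rows0 lift_perm_id.
rewrite row_permE det_mulmx det_perm odd_lift_perm /= -(det_tr U) det_trig.
  rewrite big1 => [|i _]; last by rewrite !mxE leqnn.
  by rewrite mulr1 -expr2 sqrr_sign.
by apply/is_trig_mxP => i j ij; rewrite !mxE leqNgt ij.
Qed.

(** Such a labelling has the same nonzero sum as [top_face], so some simplex has a nonzero
    determinant, and on it no label is constant. *)
Lemma discrete_poincare_miranda (lam : 'I_n -> lattice_pt -> bool) : (0 < N)%N ->
  (forall k z, grid z -> z k = 0%N -> ~~ lam k z) ->
  (forall k z, grid z -> z k = N -> lam k z) ->
  exists x : lattice_pt, (forall i, (x i < N)%N) /\
    forall k, exists z z' : lattice_pt,
      [/\ forall i, (x i <= z i <= (x i).+1)%N, forall i, (x i <= z' i <= (x i).+1)%N,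
          lam k z & ~~ lam k z'].
Proof.
move=> N0 lam0 lamN.
pose u k z : int := (lam k z)%:R.
have ub : boundary_values u.
  move=> k z zN; rewrite /u; split=> e; first by rewrite (negbTE (lam0 _ _ zN e)).
  by rewrite lamN.
pose h t (k : 'I_n) z := if (k < t)%N then top_face k z else u k z.
have hb t : boundary_values (h t).
  by move=> k z zN; rewrite /h; case: ifP => _; [apply: top_face_boundary|apply: ub].
have W t : (t <= n)%N -> kuhn_sum (affine_rows (h t)) = kuhn_sum (affine_rows u).
  elim: t => [//|t IH] tn; rewrite -(IH (ltnW tn)).
  apply: (@kuhn_sum_replace _ _ (Ordinal tn)) => // i; rewrite -val_eqE /= => it z.
  by rewrite /h ltnS leq_eqVlt (negbTE it).
have : kuhn_sum (affine_rows u) != 0.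
  rewrite -(W n) // /kuhn_sum.
  rewrite (_ : \sum_(x | _) _ = kuhn_sum (affine_rows top_face)); last first.
    apply: eq_bigr => x _; apply: eq_bigr => s _; congr (_ * determinant _).
    apply/matrixP => i j; rewrite !mxE; case: (unliftP ord0 i) => [k ->|->].
      by rewrite !affine_rows_lift /h ltn_ord.
    by rewrite !affine_rows0.
  by rewrite kuhn_sum_top_face // pnatr_eq0 -lt0n fact_gt0.
move=> W0.
have /existsP[x /andP[xin /existsP[s det0]]] : [exists x, inner x &&
    [exists s : 'S_n, \det (kuhn_mx (affine_rows u) (kuhn_vertex (base_point x) s)) != 0]].
  apply: contraNT W0 => /existsPn H; apply/eqP/big1 => x xin; apply: big1 => s _.
  by have := H x; rewrite xin /= => /existsPn/(_ s); rewrite negbK => /eqP ->; rewrite mulr0.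
exists (base_point x); split=> [i|k]; first by rewrite ffunE; apply: (forallP xin).
set w := kuhn_vertex _ _ in det0.
have wx j i : (base_point x i <= w j i <= (base_point x i).+1)%N.
  by rewrite !ffunE; case: (_ < _)%N; lia.
have /existsP[j lj] : [exists j : 'I_n.+1, lam k (w j)].
  apply: contraNT det0 => /existsPn H; rewrite (@det_affine_rows_const _ _ k 0) // => j.
  by rewrite /u (negbTE (H j)).
have /existsP[j' lj'] : [exists j : 'I_n.+1, ~~ lam k (w j)].
  apply: contraNT det0 => /existsPn H; rewrite (@det_affine_rows_const _ _ k 1) // => j'.
  by rewrite /u -[lam _ _]negbK (negbTE (H j')).
by exists (w j), (w j').
Qed.
End KuhnTriangulation.

(** * Invariance of dimension *)

Local Open Scope classical_set_scope.

Lemma compact_uniform_continuity (R : realType) (U V : pseudoMetricType R) (f : U -> V)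
    (K : set U) (e : R) : continuous f -> compact K -> 0 < e ->
  exists2 d : R, 0 < d & forall x y, K x -> ball x d y -> ball (f x) e (f y).
Proof.
move=> cf cK e0.
pose P (d : R) x := forall y, ball x d y -> ball (f x) e (f y).
have : \forall d \near 0^'+, K `<=` P d.
  apply: (proj1 (compact_near_coveringP K) cK) => x Kx.
  have [r /= r0 rx] : nbhs_ball x (fun y => ball (f x) (e / 2) (f y)).
    apply/nbhs_ballP; apply: cf; apply: nbhsx_ballx; exact: divr_gt0.
  exists (ball x (r / 2), [set d : R | d < r / 2]); first split => /=.
  - by apply: nbhsx_ballx; rewrite divr_gt0.
  - by apply: nbhs_right_lt; rewrite divr_gt0.
  - case=> x' d /= [xx' dr] y x'y.
    have x'x : ball x r x' by apply: le_ball xx'; lra.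
    have yx : ball x r y by apply: (ball_split xx'); apply: le_ball x'y; exact: ltW.
    by apply: (@ball_split _ _ (f x)); [apply: ball_sym; apply: rx | apply: rx].
move=> H; have [d [d0 Kd]] := @filter_ex _ _ (at_right_proper_filter (0 : R)) _
  (filterI (nbhs_right_gt (0 : R)) H).
by exists d => // x y Kx; apply: Kd.
Qed.

Lemma unit_cube_compact (R : realType) n :
  compact [set v : 'rV[R]_n | forall i, `[0%R, 1%R]%classic (v ord0 i)].
Proof. exact: (@rV_compact R n (fun=> `[0%R, 1%R]%classic) (fun=> @segment_compact R 0 1)). Qed.

Section DimensionInvariance.
Variable R : realType.

(* Each real lies, modulo 1, in exactly one of the m+1 intervals of length 1/(m+1)
   starting at j/(m+1), so for some j none of the m coordinates of a point of R^m
   lies in the j-th interval. *)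
Definition shifted_coord m (e : R) (j : 'I_m.+1) (y : 'rV[R]_m) (i : 'I_m) : R :=
  y ord0 i / e - j%:R / m.+1%:R.

Definition brick m e (j : 'I_m.+1) (y : 'rV[R]_m) (i : 'I_m) : int :=
  Num.floor (shifted_coord e j y i).

(** All coordinates avoid a gap of relative width 1/(m+1) at the lower end of their interval, so
    bricks of one colour are at least e/(m+1) apart. *)
Definition has_colour m e (j : 'I_m.+1) (y : 'rV[R]_m) : bool :=
  [forall i, m.+1%:R^-1 <= shifted_coord e j y i - (brick e j y i)%:~R].

Lemma exists_colour m e (y : 'rV[R]_m) : exists j, has_colour e j y.
Proof.
apply/existsP; apply: contraT => /existsPn H.
have bad j : exists i, shifted_coord e j y i - (brick e j y i)%:~R < m.+1%:R^-1.
  by have /forallPn[i] := H j; rewrite -ltNge; exists i.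
pose b j := xchoose (bad j).
have binj : injective b.
  (* If one coordinate were in the gap for both [j < j'], the two shifts would differ by at least
     1/(m+1) and at most 1 - 1/(m+1), and the floors by an integer strictly between 0 and 1. *)
  suff lt_neq (j j' : 'I_m.+1) : (j < j')%N -> b j <> b j'.
    move=> j j' e'; apply/val_inj; case: (ltngtP (j : nat) j') => // /lt_neq; first by [].
    by rewrite e'.
  move=> jj' bjj'.
  have := xchooseP (bad j'); rewrite -/(b j') -bjj'; have := xchooseP (bad j); rewrite -/(b j).
  rewrite /brick; set i := b j; set a := shifted_coord e j y i; set a' := shifted_coord e j' y i.
  have /andP[fa _] := floor_itv a; have /andP[fa' _] := floor_itv a'.
  have iM0 : (0 : R) < m.+1%:R^-1 by rewrite invr_gt0.
  have aa' : a - a' = (j'%:R - j%:R) * m.+1%:R^-1 by rewrite /a /a' /shifted_coord; ring.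
  have jj1 : 1 <= j'%:R - j%:R :> R by rewrite lerBrDl natr1 ler_nat.
  have jm : j'%:R - j%:R <= m%:R :> R.
    by rewrite lerBlDr (le_trans (y := m%:R)) ?lerDl ?ler0n // ler_nat -ltnS.
  have mM : m%:R * m.+1%:R^-1 + m.+1%:R^-1 = 1 :> R.
    by rewrite -[X in _ + X]mul1r -mulrDl natr1 mulfV ?pnatr_eq0.
  have aa'1 : m.+1%:R^-1 <= a - a' by rewrite aa' ler_peMl // ltW.
  have aa'2 : a - a' <= 1 - m.+1%:R^-1.
    by rewrite lerBrDr -[leRHS]mM lerD2r aa' ler_wpM2r // ltW.
  move: fa fa' aa'1 aa'2; rewrite /brick -/a -/a'; clearbody a a'.
  move: (m.+1%:R^-1) (Num.floor a) (Num.floor a') => M p p' pa pa' aa'1 aa'2 ra ra'.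
  have : 0 < p - p' < 1.
    by rewrite -(ltr0z R) -(ltrz1 R) intrB; apply/andP; split; lra.
  by lia.
by have := leq_card b binj; rewrite !card_ord ltnn.
Qed.
Lemma eq_brick m e (j : 'I_m.+1) (y y' : 'rV[R]_m) : 0 < e ->
  has_colour e j y -> has_colour e j y' -> ball y (e / m.+1%:R) y' ->
  brick e j y =1 brick e j y'.
Proof.
move=> e0.
suff H (z z' : 'rV[R]_m) i : has_colour e j z -> has_colour e j z' -> ball z (e / m.+1%:R) z' ->
    brick e j z i <= brick e j z' i.
  by move=> cy cy' yy' i; apply/le_anti; rewrite !H //; apply: ball_sym.
move=> /forallP/(_ i) c /forallP/(_ i) c' [_ /(_ ord0 i)]; rewrite /ball /= => zz'.
rewrite leNgt; apply/negP => lt.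
have /andP[fz _] := floor_itv (shifted_coord e j z i).
have /andP[_ fz1] := floor_itv (shifted_coord e j z' i).
have le1 : (brick e j z' i)%:~R + 1 <= (brick e j z i)%:~R :> R by rewrite -intrD1 ler_int; lia.
have zz1 : shifted_coord e j z i - shifted_coord e j z' i < m.+1%:R^-1.
  rewrite /shifted_coord opprB addrA subrK -mulrBl ltr_pdivrMr // mulrC.
  by apply: le_lt_trans zz'; exact: ler_norm.
move: c le1 fz1 zz1; rewrite /brick intrD1.
move: (m.+1%:R^-1) (shifted_coord e j z i) (shifted_coord e j z' i) => M s s'.
by move: (Num.floor s) (Num.floor s') => p p'; lra.
Qed.

Lemma brick_ball m e (j : 'I_m.+1) (y y' : 'rV[R]_m) : 0 < e ->
  brick e j y =1 brick e j y' -> ball y e y'.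
Proof.
move=> e0 yy'; split=> // a i; rewrite ord1 /ball /=.
have /andP[fz fz1] := floor_itv (shifted_coord e j y i).
have /andP[fz' fz1'] := floor_itv (shifted_coord e j y' i).
have := yy' i; rewrite /brick => ff; rewrite ff in fz fz1.
have : `|shifted_coord e j y i - shifted_coord e j y' i| < 1.
  by rewrite ltr_norml; move: fz fz1 fz' fz1'; rewrite intrD1 => *; apply/andP; split; lra.
rewrite /shifted_coord opprB addrA subrK -mulrBl normrM normfV (gtr0_norm e0).
by rewrite ltr_pdivrMr // mul1r.
Qed.

(** If m < n, each of the m+1 colours gets its own direction of the n-cube. Pulled back bricks are
    too small to join opposite faces, which is impossible as in Lebesgue's covering theorem. *)
Lemma rV_dim_le n m (phi : 'rV[R]_n -> 'rV[R]_m) (psi : 'rV[R]_m -> 'rV[R]_n) :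
  continuous phi -> continuous psi -> cancel phi psi -> (n <= m)%N.
Proof.
move=> cphi cpsi phiK; rewrite leqNgt; apply/negP => mn.
case: n => [//|p] in phi psi cphi cpsi phiK mn *.
pose K := [set v : 'rV[R]_p.+1 | forall i, `[0%R, 1%R]%classic (v ord0 i)].
have cK : compact K := @unit_cube_compact R p.+1.
have cphiK : compact (phi @` K).
  by apply: continuous_compact => //; exact: continuous_subspaceT.
(* With pulled back bricks smaller than a third of the cube, one that meets the lower third stays
   below the upper third. *)
have third0 : 0 < 3^-1 :> R by [].
have [e e0 psi_e] := compact_uniform_continuity cpsi cphiK third0.
have em0 : 0 < e / m.+1%:R by rewrite divr_gt0.
have [d d0 phi_d] := compact_uniform_continuity cphi cK em0.
(* The mesh makes two grid steps shorter than [d]; the summand 4 puts [N - 1] above two thirds of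
   [N]. *)
pose N := (Num.truncn (2 / d) + 4)%N.
have N0 : (0 < N)%N by rewrite /N addn4.
have NR0 : 0 < N%:R :> R by rewrite ltr0n.
have Nd : 2 / N%:R < d.
  rewrite ltr_pdivrMr // mulrC -ltr_pdivrMr //.
  have d20 : 0 <= 2 / d by rewrite divr_ge0 // ltW.
  by rewrite -truncn_lt_nat // /N addn4 ltnS -addn3 leq_addr.
pose pt (z : {ffun 'I_p.+1 -> nat}) : 'rV[R]_p.+1 := \row_i ((z i)%:R / N%:R).
have ptK z : grid N z -> K (pt z).
  move=> /forallP zN i; rewrite /= in_itv /= mxE divr_ge0 //=.
  by rewrite ler_pdivrMr // mul1r ler_nat.
pose col z : 'I_m.+1 := xchoose (exists_colour e (phi (pt z))).
have colP z : has_colour e (col z) (phi (pt z)) := xchooseP (exists_colour e (phi (pt z))).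
pose same (z w : {ffun 'I_p.+1 -> nat}) := col z = col w /\
  brick e (col z) (phi (pt z)) =1 brick e (col w) (phi (pt w)).
have sameT z w v : same z w -> same w v -> same z v.
  by move=> [e1 b1] [e2 b2]; split; [rewrite e1|move=> i; rewrite b1].
have same_near z w (k : 'I_p.+1) : grid N z -> grid N w -> same z w -> (3 * z k < 3 * w k + N)%N.
  move=> zN wN [czw bzw].
  have [_ /(_ ord0 k)] : ball (pt z) 3^-1 (pt w).
    rewrite -(phiK (pt z)) -(phiK (pt w)); apply: psi_e; first by exists (pt z); [apply: ptK|].
    by apply: (@brick_ball _ _ (col z)) => // i; rewrite bzw czw.
  rewrite /ball /= !mxE -mulrBl normrM normfV (gtr0_norm NR0) ltr_pdivrMr // ltr_norml.
  move=> /andP[_ H]; rewrite -(ltr_nat R) natrD !natrM; lra.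
have near_same z w : grid N z -> col z = col w -> (forall i, (z i <= w i + 2)%N && (w i <= z i + 2)%N) ->
    same z w.
  move=> zN czw zw; split=> // i; rewrite -czw; apply: eq_brick => //; first by rewrite czw.
  apply: phi_d; first exact: ptK.
  split=> // a k; rewrite ord1 /ball /= !mxE -mulrBl normrM normfV (gtr0_norm NR0).
  apply: le_lt_trans Nd; rewrite ler_pM2r ?invr_gt0 // ler_norml.
  have /andP[] := zw k; rewrite -!(ler_nat R) !natrD => *; apply/andP; split; lra.
pose low (k : 'I_p.+1) z := [/\ grid N z, (col z : nat) = k &
  exists w, [/\ grid N w, same z w & (3 * w k <= N)%N]].
(* The label is 0 on the lower face and within one step of a low point; this margin makes the labels
   at all corners of a cube say something about its base corner. *)
pose lam (k : 'I_p.+1) z := `[< z k <> 0%N /\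
  ~ exists w, low k w /\ forall i, (w i <= z i + 1)%N && (z i <= w i + 1)%N >].
have [||x [xN xlam]] := discrete_poincare_miranda (lam := lam) N0.
- by move=> k z _ zk; apply/asboolPn => -[].
- move=> k z zN zk; apply/asboolP; split; first by lia.
  move=> [w [[wN _ [w' [w'N ww' w'k]]] zw]].
  have := same_near w w' k wN w'N ww'; have := zw k; have : (4 <= N)%N by rewrite /N leq_addl.
  by lia.
have xgrid : grid N x by apply/forallP => i; exact: ltnW.
(* There are m+1 <= n colours, so the colour of [x] is a direction; the labels in that direction
   will contradict each other. *)
have ck : (col x < p.+1)%N by apply: leq_trans mn; exact: ltn_ord.
pose k := Ordinal ck.
have [z [z' [xz xz' /asboolP[_ lz] /asboolP lz']]] := xlam k.
(* A corner with label 1 shows that [x] is not low. A corner with label 0 lies on the lower face, so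
   that [x] does too, or next to a low point, which is then within two steps of [x] and in the same
   brick; either way [x] is low. *)
have [lowx|nlowx] := pselect (low k x).
  by apply: lz; exists x; split=> // i; have := xz i; lia.
apply: lz'; split=> [z'0|[w [[wN cw [w' [w'N ww' w'k]]] wz']]]; apply: nlowx; split=> //.
  exists x; split=> //; have := xz' k; lia.
exists w'; split=> //; apply: sameT ww'; apply: near_same => //.
  exact/val_inj/esym/cw.
by move=> i; have := xz' i; have := wz' i; lia.
Qed.

Lemma homeomorphic_rV_dim n m (T : topologicalType) :
  homeomorphic T 'rV[R]_n -> homeomorphic T 'rV[R]_m -> n = m.
Proof.
move=> [f [g [fK gK cf cg]]] [f' [g' [fK' gK' cf' cg']]].
apply/eqP; rewrite eqn_leq; apply/andP; split.
- apply: (@rV_dim_le _ _ (f' \o g) (f \o g')).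
  + by move=> x; apply: continuous_comp; [apply: cg|apply: cf'].
  + by move=> x; apply: continuous_comp; [apply: cg'|apply: cf].
  + by move=> x; rewrite /= fK' gK.
- apply: (@rV_dim_le _ _ (f \o g') (f' \o g)).
  + by move=> x; apply: continuous_comp; [apply: cg'|apply: cf].
  + by move=> x; apply: continuous_comp; [apply: cg|apply: cf'].
  + by move=> x; rewrite /= fK gK'.
Qed.
End DimensionInvariance.

(** * Normal forms of the matrices of a positroid cell *)

Section Minors.
Variables (R : realType) (n : nat).
Implicit Types (A B : 'M[R]_(2, n)) (i j : 'I_n).

Lemma minor2E A i j : minor2 A i j = A ord0 i * A ord_max j - A ord_max i * A ord0 j.
Proof.
have e : lift (ord0 : 'I_2) (ord0 : 'I_1) = ord_max by apply: val_inj.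
have e' : lift (ord_max : 'I_2) (ord0 : 'I_1) = ord0 by apply: val_inj.
rewrite /minor2 (expand_det_row _ ord0) !big_ord_recl big_ord0 /cofactor !det_mx11 !mxE /=.
rewrite !e e' /= addr0 expr0 expr1 (_ : tnth [tuple i; j] ord_max = j) //.
rewrite (_ : tnth [tuple i; j] ord0 = i) //; ring.
Qed.

Lemma minor2ii A i : minor2 A i i = 0.
Proof. by rewrite minor2E mulrC subrr. Qed.

Lemma minor2C A i j : minor2 A i j = - minor2 A j i.
Proof. by rewrite !minor2E; ring. Qed.

Lemma minor2M (g : 'M[R]_2) A i j : minor2 (g *m A) i j = \det g * minor2 A i j.
Proof.
rewrite /minor2 -det_mulmx; congr determinant; apply/matrixP => k l; rewrite !mxE.
by apply: eq_bigr => s _; rewrite !mxE.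
Qed.

Lemma rowspanE A : rowspan A = (<[row ord0 A]> + <[row ord_max A]>)%VS.
Proof.
rewrite /rowspan (_ : [seq _ | _ : _] = [:: row ord0 A; row ord_max A]); last first.
  rewrite /image_mem (_ : enum _ = [:: ord0; ord_max]) //.
  by apply: (inj_map val_inj); rewrite val_enum_ord.
by rewrite span_cons span_seq1.
Qed.

Lemma mem_rowspan A (v : 'rV[R]_n) :
  (v \in rowspan A) <-> exists u : 'rV[R]_2, v = u *m A.
Proof.
have rowE (u : 'rV[R]_2) : u *m A = u 0 ord0 *: row ord0 A + u 0 ord_max *: row ord_max A.
  apply/rowP => j; rewrite !mxE !big_ord_recl big_ord0 addr0.
  by congr (_ + _ * A _ _); [congr (u _ _)|]; apply: val_inj.
rewrite rowspanE; split=> [/memv_addP[v1 /vlineP[c1 ->] [v2 /vlineP[c2 ->] ->]]|[u ->]].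
  by exists (\row_k (if k == ord0 then c1 else c2)); rewrite rowE !mxE.
by rewrite rowE memv_add // memvZ // memv_line.
Qed.

Lemma rowspan_sub A B : (rowspan B <= rowspan A)%VS -> exists g : 'M[R]_2, B = g *m A.
Proof.
move=> /subvP BA.
have H k : exists u : 'rV[R]_2, row k B = u *m A.
  by apply/mem_rowspan/BA/mem_rowspan; exists (delta_mx 0 k); rewrite rowE.
pose f k := projT1 (cid (H k)); exists (\matrix_k f k).
by apply/row_matrixP => k; rewrite row_mul rowK; exact: (projT2 (cid (H k))).
Qed.

Lemma rowspanM (g : 'M[R]_2) A : (rowspan (g *m A) <= rowspan A)%VS.
Proof.
by apply/subvP => v /mem_rowspan[u ->]; apply/mem_rowspan; exists (u *m g); rewrite mulmxA.
Qed.

Lemma dim_rowspan A i j : minor2 A i j != 0 -> \dim (rowspan A) == 2%N.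
Proof.
move=> m0; rewrite rowspanE.
have [r00 r0 r1] : [/\ row ord0 A != 0, row ord_max A != 0 &
    forall c, row ord0 A != c *: row ord_max A].
  split=> [||c]; apply: contraNN m0 => /eqP/rowP H; have := H i; have := H j;
    rewrite minor2E !mxE => -> ->; apply/eqP; ring.
rewrite dimv_disjoint_sum ?dim_vline ?r00 ?r0 //.
apply/eqP; rewrite -subv0; apply/subvP => v; rewrite memv_cap => /andP[/vlineP[c ->] /vlineP[d]].
have [->|c0] := eqVneq c 0; first by rewrite scale0r mem0v.
move=> H; case/eqP: (r1 (c^-1 * d)).
by rewrite -scalerA -H scalerA mulVf // scale1r.
Qed.
End Minors.

(** * Continuity of ratios of minors on the Grassmannian *)

Section Ratio.
Variables (R : realType) (n : nat).
Variables (a b : 'I_n).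
Implicit Types (A B : 'M[R]_(2, n)) (i j : 'I_n) (V : Gr2 R n).

Definition Gr2_rep V : 'M[R]_(2, n) := xget 0 [set A | rowspan A = sval V].

(* The minors of a spanning matrix are projective coordinates; dividing by the
   one at [a, b] makes them functions on the Grassmannian. *)
Definition minor_ratio V i j : R := minor2 (Gr2_rep V) i j / minor2 (Gr2_rep V) a b.

Lemma minor_ratioE V A i j : rowspan A = sval V -> minor_ratio V i j = minor2 A i j / minor2 A a b.
Proof.
move=> AV; rewrite /minor_ratio; set B := Gr2_rep V.
have BV : rowspan B = sval V by apply: (xgetPex 0 (P := [set A | rowspan A = sval V])); exists A.
have [g gE] : exists g, B = g *m A by apply: rowspan_sub; rewrite BV AV.
have [h hE] : exists g, A = g *m B by apply: rowspan_sub; rewrite BV AV.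
have mA k l : minor2 A k l = \det h * (\det g * minor2 A k l).
  by rewrite -!minor2M -gE -hE.
rewrite gE !minor2M; have [z|nz] := eqVneq (minor2 A a b) 0.
  by rewrite z mulr0 !invr0 !mulr0.
have g0 : \det g != 0.
  by apply: contra_neq nz => g0; rewrite mA g0 mul0r mulr0.
by rewrite -mulf_div divff // mul1r.
Qed.

Lemma minor2_continuous i j : continuous (fun A => minor2 A i j : R).
Proof.
have -> : (fun A => minor2 A i j : R) =
    ((fun A => A ord0 i : R) \* (fun A => A ord_max j : R)) -
    ((fun A => A ord_max i : R) \* (fun A => A ord0 j : R)).
  by apply/funext => A; rewrite minor2E.
have cc k l A : {for A, continuous (fun A => A k l : R)} by exact: coord_continuous.
by move=> A; apply: continuousB; apply: continuousM; exact: cc.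
Qed.

Lemma Gr2_of_frame_continuous : continuous (@Gr2_of_frame R n).
Proof. by apply/continuousP => U oU; exact: oU. Qed.

Lemma minor_ratio_continuous V i j : (exists2 A, rowspan A = sval V & minor2 A a b != 0) ->
  {for V, continuous (fun V => minor_ratio V i j)}.
Proof.
move=> [A AV m0] W; rewrite (minor_ratioE i j AV) => nW.
pose q B : R := minor2 B i j / minor2 B a b.
pose O : set 'M[R]_(2, n) := [set B | minor2 B a b != 0 /\ W° (q B)].
have oO : open O.
  rewrite openE => B [B0 BW]; apply: filterI.
    have n0 : nbhs (minor2 B a b) [set x : R | x != 0].
      by apply: open_nbhs_nbhs; split; [exact: open_neq|].
    exact: (minor2_continuous n0).
  suff qB : {for B, continuous q} by apply: qB; apply: open_nbhs_nbhs; split => //; exact: open_interior.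
  apply: (continuousM (minor2_continuous (x := B))).
  have mB : {for B, continuous (fun A => minor2 A a b : R)} by exact: minor2_continuous.
  exact: (continuousV (s := fun A => minor2 A a b : R) B0 mB).
(* Membership in [O] depends on the row span only, so the preimage of [U] among the frames is the
   trace of [O]. *)
pose U : set (Gr2 R n) := [set V | exists2 A, rowspan A = sval V & O A].
have oU : open U.
  suff : Gr2_open U by [].
  exists O => //; apply/seteqP; split=> F /= => [OF|[B BF [B0 WB]]]; first by exists (set_val F).
  have [g gE] : exists g, B = g *m set_val F by apply: rowspan_sub; rewrite BF.
  have F0 : minor2 (set_val F) a b != 0.
    by apply: contra_neq B0 => F0; rewrite gE minor2M F0 mulr0.
  split=> //; move: WB; rewrite /q -(minor_ratioE (V := Gr2_of_frame F) i j BF).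
  by rewrite (minor_ratioE (V := Gr2_of_frame F) i j (erefl : rowspan (set_val F) = _)).
have : nbhs V U.
  apply: open_nbhs_nbhs; split=> //; exists A => //; split=> //; exact: nW.
apply: filterS => V' [A' A'V' [_ /interior_subset]].
by rewrite /q -(minor_ratioE i j A'V').
Qed.
End Ratio.

Lemma row2_cases (k : 'I_2) : k = ord0 \/ k = ord_max.
Proof. by case: k => -[|[]] //= ?; [left | right]; apply: val_inj. Qed.

Section Realization.
Variables (R : realType) (n : nat).
Implicit Types (A B N : 'M[R]_(2, n)) (i j : 'I_n) (P : {set {set 'I_n}}).

Definition realizes A P := forall i j, (i < j)%N ->
  if [set i; j]%SET \in P then 0 < minor2 A i j else minor2 A i j == 0.

Lemma positroid_cellP P (V : Gr2 R n) :
  positroid_cell R P V <-> exists2 A, rowspan A = sval V & realizes A P.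
Proof.
split=> [[]//|[A AV rA]]; split; exists A => // i j ij.
by have := rA i j ij; case: ifP => _; [exact: ltW | move=> /eqP ->].
Qed.

Lemma realizes_gt0 A P i j : realizes A P -> (i < j)%N -> [set i; j]%SET \in P ->
  0 < minor2 A i j.
Proof. by move=> rA ij ijP; have := rA i j ij; rewrite ijP. Qed.

Lemma realizes_ge0 A P i j : realizes A P -> (i < j)%N -> 0 <= minor2 A i j.
Proof.
by move=> rA ij; have := rA i j ij; case: ifP => _; [exact: ltW | move=> /eqP ->].
Qed.

Lemma pairs_neq P i j : P \subset pairs n -> [set i; j]%SET \in P -> i != j.
Proof.
by move=> /fintype.subsetP PP /PP; rewrite /pairs inE cards2; case: (i != j).
Qed.

Lemma realizes_eq0 A P i j : P \subset pairs n -> realizes A P ->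
  (minor2 A i j == 0) = ([set i; j]%SET \notin P).
Proof.
move=> PP rA; case: (ltngtP i j) => ij.
- by have := rA i j ij; case: ifP => _ => [|->//] /lt0r_neq0/negbTE.
- rewrite minor2C oppr_eq0 finset.setUC; have := rA j i ij.
  by case: ifP => _ => [|->//] /lt0r_neq0/negbTE.
- rewrite (val_inj ij) minor2ii eqxx; apply/esym/negP => /(pairs_neq PP).
  by rewrite eqxx.
Qed.

Lemma realizes_sign A P i j : P \subset pairs n -> realizes A P -> [set i; j]%SET \in P ->
  (0 < minor2 A i j) = (i < j)%N.
Proof.
move=> PP rA ijP; case: (ltngtP i j) => ij.
- by rewrite (realizes_gt0 rA).
- by rewrite minor2C oppr_gt0 lt_gtF // (realizes_gt0 rA) // finset.setUC.
- by have := pairs_neq PP ijP; rewrite (val_inj ij) eqxx.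
Qed.

Lemma dim_rowspan_realizes A P : P \subset pairs n -> P != finset.set0 -> realizes A P ->
  \dim (rowspan A) == 2%N.
Proof.
move=> PP /finset.set0Pn[I IP] rA.
have := fintype.subsetP PP _ IP; rewrite /pairs inE => /cards2P[i [j [_ IE]]].
by apply: (@dim_rowspan _ _ A i j); rewrite (realizes_eq0 _ _ PP rA) negbK -IE.
Qed.

(** By Cramer's rule, [A] multiplied by the inverse of its submatrix on the columns [a] and [b],
    when that is invertible. *)
Definition normal_form (a b : 'I_n) A : 'M[R]_(2, n) :=
  \matrix_(k, j) ((if k == ord0 then minor2 A j b else minor2 A a j) / minor2 A a b).

Lemma normal_form0 a b A j : normal_form a b A ord0 j = minor2 A j b / minor2 A a b.
Proof. by rewrite mxE. Qed.

Lemma normal_form1 a b A j : normal_form a b A ord_max j = minor2 A a j / minor2 A a b.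
Proof. by rewrite mxE. Qed.

Lemma minor2_normal_form a b A i j : minor2 A a b != 0 ->
  minor2 (normal_form a b A) i j = minor2 A i j / minor2 A a b.
Proof.
move=> D0; rewrite [LHS]minor2E !normal_form0 !normal_form1.
by rewrite !minor2E in D0 *; field.
Qed.

Lemma rowspan_normal_form a b A : minor2 A a b != 0 ->
  rowspan (normal_form a b A) = rowspan A.
Proof.
move=> D0; apply/eqP; rewrite eqEdim.
have D1 : minor2 (normal_form a b A) a b != 0 by rewrite minor2_normal_form // divff ?oner_eq0.
rewrite (eqP (dim_rowspan D0)) (eqP (dim_rowspan D1)) leqnn andbT.
pose g : 'M[R]_2 := \matrix_(k, l)
  ((if k == ord0 then if l == ord0 then A ord_max b else - A ord0 b
    else if l == ord0 then - A ord_max a else A ord0 a) / minor2 A a b).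
rewrite (_ : normal_form a b A = g *m A) ?rowspanM //.
apply/matrixP => k j; rewrite !mxE !big_ord_recl big_ord0 !mxE /= addr0.
have -> : lift (ord0 : 'I_2) (ord0 : 'I_1) = ord_max by apply: val_inj.
by case: ifP => _; rewrite !minor2E in D0 *; field.
Qed.

Lemma realizes_normal_form P (a b : 'I_n) A : realizes A P -> (a < b)%N -> [set a; b]%SET \in P ->
  realizes (normal_form a b A) P.
Proof.
move=> rA ab abP i j ij; have D0 := realizes_gt0 rA ab abP.
rewrite minor2_normal_form ?lt0r_neq0 //; have := rA i j ij.
by case: ifP => _ => [m0|/eqP ->]; [exact: divr_gt0 | rewrite mul0r].
Qed.

End Realization.

(** * Scale and slope coordinates of normalized matrices *)

Section CellCoordinates.
Variables (R : realType) (n : nat) (P : {set {set 'I_n}}) (a b : 'I_n).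
Implicit Types (N : 'M[R]_(2, n)) (i j q : 'I_n).

Definition nonloops : {set 'I_n} := [set i | [exists j, [set i; j]%SET \in P]]%SET.

(* With column [a] at (1,0) and [b] at (0,1), the nonzero columns, in increasing
   order, run through the half-open first quadrant (front), the positive vertical
   axis (upright) and the negative horizontal axis (tail). *)
Definition front j := [&& j \in nonloops, (j <= b)%N & [set j; b]%SET \in P].
Definition upright j := [&& j \in nonloops, (j <= b)%N & [set j; b]%SET \notin P].
Definition tail j := (j \in nonloops) && (b < j)%N.

(* The elements at which the slope of the front columns increases. *)
Definition jump q := [&& front q, q != a &
  [forall i, (i \in nonloops) && (i < q)%N ==> ([set i; q]%SET \in P)]].

(** The default [a] of the arg max is itself a candidate when [q] is a front element other than [a],
    provided [a] is the least nonloop. *)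
Definition prev q := [arg max_(i > a | front i && (i < q)%N) (i : nat)]%N.

(** Recording slopes by their increments at jumps turns the inequalities between slopes into
    independent positivity conditions. *)
Definition slope_of (s : 'I_n -> R) j := \sum_(q | jump q && (q <= j)%N) s q.

Definition matrix_of (r s : 'I_n -> R) : 'M[R]_(2, n) := \matrix_(k, j)
  if k == ord0 then if front j then r j else if tail j then - r j else 0
  else if front j then r j * slope_of s j else if upright j then r j else 0.

Definition slope N j := N ord_max j / N ord0 j.
Definition scale_coord N j :=
  if front j then N ord0 j else if tail j then - N ord0 j else N ord_max j.
Definition step_coord N q := slope N q - slope N (prev q).

Hypotheses (PP : P \subset pairs n) (abP : [set a; b]%SET \in P).
Hypothesis a_min : forall j, j \in nonloops -> (a <= j)%N.
Hypothesis b_max : forall j, [set a; j]%SET \in P -> (j <= b)%N.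

Lemma nonloopsP i j : [set i; j]%SET \in P -> i \in nonloops /\ j \in nonloops.
Proof.
by move=> ijP; rewrite !inE; split; apply/existsP; [exists j | exists i; rewrite finset.setUC].
Qed.

Lemma a_lt_b : (a < b)%N.
Proof.
rewrite ltn_neqAle (pairs_neq PP abP) /= a_min //; exact: (nonloopsP abP).2.
Qed.

Lemma front_a : front a.
Proof. by rewrite /front abP (nonloopsP abP).1 ltnW // a_lt_b. Qed.

Lemma upright_b : upright b.
Proof.
rewrite /upright (nonloopsP abP).2 leqnn /=; apply/negP => /(pairs_neq PP).
by rewrite eqxx.
Qed.

Lemma nonloop_cases j : j \in nonloops -> [|| front j, upright j | tail j].
Proof. by rewrite /front /upright /tail => ->; case: leqP => //=; case: (_ \in P). Qed.

Lemma upright_front j : upright j -> front j = false.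
Proof. by case/and3P => _ _ /negbTE jbP; rewrite /front jbP !andbF. Qed.

Lemma tail_front j : tail j -> front j = false.
Proof. by case/andP => _ bj; rewrite /front leqNgt bj andbF. Qed.

Lemma tail_upright j : tail j -> upright j = false.
Proof. by case/andP => _ bj; rewrite /upright leqNgt bj andbF. Qed.

Lemma upright_tail j : upright j -> tail j = false.
Proof. by case/and3P => _ jb _; rewrite /tail ltnNge jb andbF. Qed.

Lemma prevP q : front q -> q != a ->
  [/\ front (prev q), (prev q < q)%N & forall i, front i -> (i < q)%N -> (i <= prev q)%N].
Proof.
move=> fq qa; rewrite /prev; case: arg_maxnP => [|i /andP[fi iq] H].
  by rewrite front_a ltn_neqAle eq_sym qa a_min //; case/and3P: fq.
by split=> // i' fi' i'q; apply: H; rewrite fi' i'q.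
Qed.

Lemma jump_front q : jump q -> front q. Proof. by case/and3P. Qed.

Lemma slope_of_prev s q : front q -> q != a ->
  slope_of s q = (if jump q then s q else 0) + slope_of s (prev q).
Proof.
move=> fq qa; have [fp pq pmax] := prevP fq qa.
rewrite /slope_of (bigID (fun i => i == q)) /=; congr (_ + _).
  rewrite (eq_bigl (fun i => (i == q) && jump q)) => [|i].
    by case: ifP => jq; [rewrite (big_pred1 q) // => i; rewrite andbT
                        | rewrite big_pred0 // => i; rewrite andbF].
  by rewrite andbC; case: eqP => // ->; rewrite leqnn andbT.
apply: eq_bigl => i; case ji : (jump i) => //=.
have fi := jump_front ji; apply/andP/idP => [[iq ne]|ip].
  by apply: pmax => //; rewrite ltn_neqAle ne.
by have iq := leq_ltn_trans ip pq; rewrite ltnW // -val_eqE neq_ltn iq.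
Qed.


Lemma slope_of_split s i j : (i <= j)%N ->
  slope_of s j = slope_of s i + \sum_(q | jump q && (i < q <= j)%N) s q.
Proof.
move=> ij; rewrite /slope_of (bigID (fun q : 'I_n => q <= i)%N) /=; congr (_ + _).
  by apply: eq_bigl => q; case: (jump q) => //=; apply/andP/idP => [[]|] //; lia.
by apply: eq_bigl => q; case: (jump q) => //=; lia.
Qed.

Lemma slope_of_le s i j : (forall q, jump q -> 0 < s q) -> (i <= j)%N ->
  slope_of s i <= slope_of s j.
Proof.
move=> s0 ij; rewrite (slope_of_split s ij) lerDl; apply: sumr_ge0 => q /andP[/s0 sq _].
exact: ltW.
Qed.

Lemma slope_of_lt s i j : (forall q, jump q -> 0 < s q) -> (i <= j)%N ->
  (slope_of s i < slope_of s j) = [exists q, jump q && (i < q <= j)%N].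
Proof.
move=> s0 ij; rewrite (slope_of_split s ij) ltrDl; apply/idP/existsP => [|[q qP]].
  rewrite lt0r => /andP[+ _]; apply: contra_neqP => H; apply: big1 => q qP.
  by case: H; exists q.
rewrite (bigD1 q) //= ltr_wpDr //; last by case/andP: qP => /s0.
by apply: sumr_ge0 => q' /andP[/andP[/s0 sq' _] _]; exact: ltW.
Qed.

Lemma slope_of_a s : slope_of s a = 0.
Proof.
rewrite /slope_of big_pred0 // => q; apply/negP => /andP[/and3P[fq qa _] qa'].
by case/and3P: fq => /a_min aq _ _; case/eqP: qa; apply/val_inj/eqP; rewrite eqn_leq qa'.
Qed.

Section NormalForm.
Variable N : 'M[R]_(2, n).
Hypotheses (N0a : N ord0 a = 1) (N1a : N ord_max a = 0).
Hypotheses (N0b : N ord0 b = 0) (N1b : N ord_max b = 1).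
Hypothesis rN : realizes N P.

Lemma minor2_b j : minor2 N j b = N ord0 j.
Proof. by rewrite minor2E N0b N1b mulr1 mulr0 subr0. Qed.

Lemma minor2_a j : minor2 N a j = N ord_max j.
Proof. by rewrite minor2E N0a N1a mul1r mul0r subr0. Qed.

Lemma N0_eq0 j : (N ord0 j == 0) = ([set j; b]%SET \notin P).
Proof. by rewrite -minor2_b (realizes_eq0 _ _ PP rN). Qed.

Lemma N1_eq0 j : (N ord_max j == 0) = ([set a; j]%SET \notin P).
Proof. by rewrite -minor2_a (realizes_eq0 _ _ PP rN). Qed.

Lemma nonloop_col j : (j \in nonloops) = ~~ ((N ord0 j == 0) && (N ord_max j == 0)).
Proof.
apply/idP/idP => [|/nandP[]].
- rewrite inE => /existsP[i jiP]; apply/negP => /andP[/eqP x0 /eqP y0].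
  have : minor2 N j i == 0 by rewrite minor2E x0 y0 !mul0r subrr.
  by rewrite (realizes_eq0 _ _ PP rN) jiP.
- by rewrite N0_eq0 negbK => /nonloopsP[].
- by rewrite N1_eq0 negbK => /nonloopsP[].
Qed.

Lemma loop_col k j : j \notin nonloops -> N k j = 0.
Proof.
rewrite nonloop_col negbK => /andP[/eqP x0 /eqP y0].
by have [->|->] := row2_cases k.
Qed.

Lemma front_N0 j : front j -> 0 < N ord0 j.
Proof.
case/and3P => _ jb jbP; rewrite -minor2_b; apply: (realizes_gt0 rN) => //.
by rewrite ltn_neqAle jb andbT; exact: (pairs_neq PP jbP).
Qed.

Lemma N1_ge0 j : 0 <= N ord_max j.
Proof.
have [aj|ja] := ltnP a j; first by rewrite -minor2_a (realizes_ge0 rN).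
have [jE|jE] := boolP (j \in nonloops); last by rewrite loop_col.
by rewrite (_ : j = a) ?N1a //; apply/val_inj/eqP; rewrite eqn_leq ja a_min.
Qed.

Lemma upright_col j : upright j -> N ord0 j = 0 /\ 0 < N ord_max j.
Proof.
case/and3P => jE jb; rewrite -N0_eq0 => x0; split; first exact/eqP.
by rewrite lt0r N1_ge0 andbT; move: jE; rewrite nonloop_col x0.
Qed.

(** By maximality of [b], a later nonloop is parallel to [a]; its minor with [b] forces the negative
    direction. *)
Lemma tail_col j : tail j -> N ord_max j = 0 /\ N ord0 j < 0.
Proof.
case/andP => jE bj; have y0 : N ord_max j = 0.
  by apply/eqP; rewrite N1_eq0; apply/negP => /b_max; rewrite leqNgt bj.
split=> //; have := jE; rewrite nonloop_col y0 eqxx andbT => x0.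
rewrite lt_neqAle x0 /= -minor2_b minor2C oppr_le0.
exact: (realizes_ge0 rN).
Qed.

Lemma front_minor i j : front i -> front j ->
  minor2 N i j = N ord0 i * N ord0 j * (slope N j - slope N i).
Proof.
move=> /front_N0/lt0r_neq0 xi /front_N0/lt0r_neq0 xj; rewrite minor2E /slope; field.
by rewrite xi xj.
Qed.

Lemma front_slope_le i j : front i -> front j -> (i <= j)%N -> slope N i <= slope N j.
Proof.
move=> fi fj; rewrite leq_eqVlt => /orP[/eqP/val_inj -> //|ij].
have := realizes_ge0 rN ij; rewrite front_minor //.
by rewrite pmulr_rge0 ?subr_ge0 // mulr_gt0 // front_N0.
Qed.

Lemma front_slope_eq i j : front i -> front j ->
  (slope N i == slope N j) = ([set i; j]%SET \notin P).
Proof.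
move=> fi fj; rewrite -(realizes_eq0 _ _ PP rN) front_minor //.
have x0 : N ord0 i * N ord0 j != 0 by rewrite mulf_neq0 // gt_eqF // front_N0.
by rewrite mulf_eq0 (negbTE x0) subr_eq0 eq_sym.
Qed.

Lemma slope_a : slope N a = 0. Proof. by rewrite /slope N1a mul0r. Qed.

Lemma parallel_front i j : front j -> (i < j)%N -> i \in nonloops ->
  [set i; j]%SET \notin P -> front i.
Proof.
move=> fj ij iE; rewrite -(realizes_eq0 _ _ PP rN) minor2E => m0.
have ib : (i <= b)%N by case/and3P: fj => _ jb _; apply: leq_trans (ltnW ij) jb.
have := nonloop_cases iE; rewrite /tail ltnNge ib andbF orbF => /orP[//|/upright_col[x0 y0]].
by move: m0; rewrite x0 mul0r sub0r oppr_eq0 mulf_eq0 !gt_eqF ?front_N0.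
Qed.

Lemma step_coord_gt0 q : jump q -> 0 < step_coord N q.
Proof.
case/and3P => fq qa /forallP/(_ (prev q)); have [fp pq pmax] := prevP fq qa.
rewrite pq andbT (_ : prev q \in nonloops) /= => [pqP|]; last by case/and3P: fp.
rewrite subr_gt0 lt_neqAle front_slope_le // 1?ltnW // andbT.
by rewrite front_slope_eq // negbK.
Qed.

(** An element that is not a jump is parallel to an earlier front element, and monotonicity squeezes
    the slope of [prev j] between the two. *)
Lemma no_jump_slope j : front j -> j != a -> ~~ jump j -> slope N j = slope N (prev j).
Proof.
move=> fj ja nj; have [fp pj pmax] := prevP fj ja.
move: nj; rewrite /jump fj ja /= => /forallPn[i]; rewrite negb_imply => /andP[/andP[iE ij] ijP].
have fi := parallel_front fj ij iE ijP.
apply/le_anti; rewrite (front_slope_le fp fj (ltnW pj)) andbT.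
have /eqP <- : slope N i == slope N j by rewrite front_slope_eq.
exact: front_slope_le (pmax i fi ij).
Qed.

Lemma slope_of_step j : front j -> slope_of (step_coord N) j = slope N j.
Proof.
have [m] := ubnP (j : nat); elim: m j => // m IH j jm fj.
have [->|ja] := eqVneq j a.
  by rewrite slope_a slope_of_a.
have [fp pj pmax] := prevP fj ja.
rewrite slope_of_prev // IH ?(leq_trans pj) //.
by case: ifPn => [_|/no_jump_slope -> //]; rewrite ?add0r // /step_coord subrK.
Qed.

Lemma matrix_of_coords : matrix_of (scale_coord N) (step_coord N) = N.
Proof.
apply/matrixP => k j; rewrite mxE /scale_coord.
have [jE|jE] := boolP (j \in nonloops); last first.
  by rewrite /front /upright /tail (negbTE jE) /= loop_col // if_same.
have [fj|uj|tj] := or3P (nonloop_cases jE).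
- have [->|->] := row2_cases k; rewrite /= fj // slope_of_step // /slope mulrC divfK //.
  by rewrite gt_eqF // front_N0.
- rewrite (upright_tail uj) uj (upright_front uj).
  by have [->|->] := row2_cases k; rewrite //= (upright_col uj).1.
- rewrite tj (tail_front tj) (tail_upright tj).
  by have [->|->] := row2_cases k; rewrite /= ?opprK // (tail_col tj).1.
Qed.

Lemma scale_coord_gt0 j : j \in nonloops -> 0 < scale_coord N j.
Proof.
move=> /nonloop_cases; rewrite /scale_coord; case fj : (front j) => /=; first by move=> _; exact: front_N0.
case/orP => [uj|tj]; first by rewrite (upright_tail uj) (upright_col uj).2.
by rewrite tj oppr_gt0 (tail_col tj).2.
Qed.

(** The right side does not involve [N]: one normalized realization fixes the criterion, which then
    serves for every [matrix_of r s]. *)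
Lemma front_pair i j : front i -> front j -> (i <= j)%N ->
  ([set i; j]%SET \in P) = [exists q, jump q && (i < q <= j)%N].
Proof.
move=> fi fj ij; rewrite -[LHS]negbK -front_slope_eq // -(slope_of_lt step_coord_gt0 ij).
by rewrite !slope_of_step // lt_neqAle front_slope_le // andbT.
Qed.

(** A tail column is a negative multiple of column [a], so the question reduces to the pair of [a]
    and [i]. *)
Lemma front_tail_pair i j : front i -> tail j ->
  ([set i; j]%SET \in P) = [exists q, jump q && (a < q <= i)%N].
Proof.
move=> fi tj; rewrite -front_pair ?front_a ?a_min //; last by case/and3P: fi.
rewrite -[LHS]negbK -[RHS]negbK -(realizes_eq0 _ _ PP rN) -N1_eq0 minor2E (tail_col tj).1.
by rewrite mulr0 sub0r oppr_eq0 mulf_eq0 [X in _ || X]lt_eqF ?(tail_col tj).2 // orbF.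
Qed.

Section MatrixOf.
Variables r s : 'I_n -> R.
Hypothesis r_gt0 : forall j, j \in nonloops -> 0 < r j.
Hypothesis s_gt0 : forall q, jump q -> 0 < s q.

Lemma matrix_of_front j : front j ->
  (matrix_of r s ord0 j = r j) * (matrix_of r s ord_max j = r j * slope_of s j).
Proof. by move=> fj; rewrite !mxE fj. Qed.

Lemma matrix_of_upright j : upright j ->
  (matrix_of r s ord0 j = 0) * (matrix_of r s ord_max j = r j).
Proof.
by move=> uj; rewrite !mxE uj (upright_tail uj) (upright_front uj).
Qed.

Lemma matrix_of_tail j : tail j ->
  (matrix_of r s ord0 j = - r j) * (matrix_of r s ord_max j = 0).
Proof.
by move=> tj; rewrite !mxE tj (tail_front tj) (tail_upright tj).
Qed.

Lemma matrix_of_loop k j : j \notin nonloops -> matrix_of r s k j = 0.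
Proof. by move=> /negbTE jE; rewrite mxE /front /upright /tail jE /= if_same. Qed.

Lemma realizes_matrix_of : realizes (matrix_of r s) P.
Proof.
move=> i j ij.
have [iE|iE] := boolP (i \in nonloops); last first.
  rewrite minor2E !(matrix_of_loop _ iE) !mul0r subrr eqxx.
  by case: ifP => // /nonloopsP[]; rewrite (negbTE iE).
have [jE|jE] := boolP (j \in nonloops); last first.
  rewrite minor2E !(matrix_of_loop _ jE) !mulr0 subrr eqxx.
  by case: ifP => // /nonloopsP[_]; rewrite (negbTE jE).
have ri := r_gt0 iE; have rj := r_gt0 jE.
have sgn := rN ij.
have/or3P[fi|ui|ti] := nonloop_cases iE; have/or3P[fj|uj|tj] := nonloop_cases jE.
- rewrite front_pair // ?(ltnW ij) // -(slope_of_lt s_gt0 (ltnW ij)) minor2E.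
  rewrite !(matrix_of_front fi) !(matrix_of_front fj).
  have -> : r i * (r j * slope_of s j) - r i * slope_of s i * r j =
     r i * r j * (slope_of s j - slope_of s i) by ring.
  rewrite pmulr_rgt0 ?mulr_gt0 // subr_gt0; case: ifP => // /negbT.
  have rr0 : r i * r j != 0 by rewrite mulf_neq0 // gt_eqF.
  rewrite -leNgt mulf_eq0 (negbTE rr0) subr_eq0 => le.
  by rewrite eq_le le slope_of_le // ltnW.
- have ijP : [set i; j]%SET \in P.
    rewrite -[_ \in P]negbK -(realizes_eq0 _ _ PP rN) minor2E (upright_col uj).1 mulr0 subr0.
    by rewrite mulf_eq0 !gt_eqF ?front_N0 ?(upright_col uj).2.
  rewrite ijP minor2E (matrix_of_front fi).1 (matrix_of_upright uj).1 (matrix_of_upright uj).2.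
  by rewrite mulr0 subr0 mulr_gt0.
- rewrite (front_tail_pair fi tj) -(slope_of_lt s_gt0 (a_min iE)) minor2E.
  rewrite !(matrix_of_front fi) !(matrix_of_tail tj) slope_of_a mulr0 sub0r mulrN opprK.
  rewrite pmulr_lgt0 // pmulr_rgt0 //; case: ifP => // /negbT; rewrite -leNgt => le.
  have : 0 <= slope_of s i by rewrite -(slope_of_a s) slope_of_le // a_min.
  by move=> ge; rewrite !mulf_eq0 [slope_of s i == 0]eq_le le ge orbT.
(* An upright column cannot precede a front one, as the minor in [N] would be negative. *)
- have := realizes_ge0 rN ij; rewrite minor2E (upright_col ui).1 mul0r sub0r oppr_ge0.
  by rewrite leNgt mulr_gt0 ?front_N0 ?(upright_col ui).2.
- move: sgn; rewrite !minor2E (upright_col ui).1 (upright_col uj).1.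
  rewrite (matrix_of_upright ui).1 (matrix_of_upright uj).1 !mulr0 !mul0r subrr.
  by case: ifP => //; rewrite ltxx.
- have ijP : [set i; j]%SET \in P.
    rewrite -[_ \in P]negbK -(realizes_eq0 _ _ PP rN) minor2E (upright_col ui).1 mul0r sub0r.
    by rewrite oppr_eq0 mulf_eq0 negb_or gt_eqF ?(upright_col ui).2 // lt_eqF ?(tail_col tj).2.
  rewrite ijP minor2E (matrix_of_upright ui).1 (matrix_of_upright ui).2 (matrix_of_tail tj).1.
  by rewrite mul0r sub0r mulrN opprK mulr_gt0.
- by case/andP: ti => _ bi; case/and3P: fj => _ jb _; lia.
- by case/andP: ti => _ bi; case/and3P: uj => _ jb _; lia.
- move: sgn; rewrite !minor2E (tail_col ti).1 (tail_col tj).1.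
  rewrite (matrix_of_tail ti).2 (matrix_of_tail tj).2 !mulr0 !mul0r subrr.
  by case: ifP => //; rewrite ltxx.
Qed.

Lemma scale_coord_matrix_of j : j \in nonloops -> scale_coord (matrix_of r s) j = r j.
Proof.
move=> /nonloop_cases/or3P[fj|uj|tj]; rewrite /scale_coord.
- by rewrite fj (matrix_of_front fj).1.
- by rewrite (upright_tail uj) (upright_front uj) (matrix_of_upright uj).2.
- by rewrite tj (tail_front tj) (matrix_of_tail tj).1 opprK.
Qed.

Lemma slope_matrix_of j : front j -> slope (matrix_of r s) j = slope_of s j.
Proof.
move=> fj; rewrite /slope !(matrix_of_front fj) mulrC mulKf //.
by rewrite gt_eqF // r_gt0 //; case/and3P: fj.
Qed.

Lemma step_coord_matrix_of q : jump q -> step_coord (matrix_of r s) q = s q.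
Proof.
move=> jq; have /and3P[fq qa _] := jq; have [fp _ _] := prevP fq qa.
by rewrite /step_coord !slope_matrix_of // (slope_of_prev s fq qa) jq addrK.
Qed.

Lemma matrix_of_normal : r a = 1 -> r b = 1 ->
  [/\ matrix_of r s ord0 a = 1, matrix_of r s ord_max a = 0,
     matrix_of r s ord0 b = 0 & matrix_of r s ord_max b = 1].
Proof.
move=> ra rb; rewrite !(matrix_of_front front_a) !(matrix_of_upright upright_b).
by rewrite slope_of_a mulr0.
Qed.

End MatrixOf.

End NormalForm.

End CellCoordinates.

(** * A homeomorphism from a positroid cell to a real vector space *)

Lemma mx_continuous_at (R : realType) (T : topologicalType) m n (f : T -> 'M[R]_(m, n)) (x : T) :
  (forall i j, {for x, continuous (fun y => f y i j : R)}) -> {for x, continuous f}.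
Proof.
move=> fc B [Q nQ QB]; apply: (filterS (P := fun y => forall i j, Q i j (f y i j))).
  by move=> y; exact: QB.
by apply: filter_forall => i; apply: filter_forall => j; apply: fc; exact: nQ.
Qed.

Lemma sum_continuous (R : realType) (T : topologicalType) (I : Type) (r : seq I) (p : pred I)
    (f : I -> T -> R) : (forall i, continuous (f i)) ->
  continuous (fun x => \sum_(i <- r | p i) f i x).
Proof.
move=> fc; elim: r => [|i r IH].
  rewrite (_ : (fun x => _) = cst 0); first exact: cst_continuous.
  by apply/funext => x; rewrite big_nil.
case pi : (p i).
  rewrite (_ : (fun x => _) = (f i) + (fun x => \sum_(i <- r | p i) f i x)).
    by move=> x; apply: continuousD; [exact: fc | exact: IH].
  by apply/funext => x; rewrite big_cons pi.
rewrite (_ : (fun x => _) = (fun x => \sum_(i <- r | p i) f i x)) //.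
by apply/funext => x; rewrite big_cons pi.
Qed.

Section Chart.
Variables (R : realType) (n : nat) (P : {set {set 'I_n}}) (a b : 'I_n).
Hypotheses (PP : P \subset pairs n) (abP : [set a; b]%SET \in P).
Hypothesis a_min : forall j, j \in nonloops P -> (a <= j)%N.
Hypothesis b_max : forall j, [set a; j]%SET \in P -> (j <= b)%N.
Hypothesis P_realizable : exists A : 'M[R]_(2, n), realizes A P.

Definition chart_index : {set 'I_n + 'I_n} := [set k | match k with
  | inl j => [&& j \in nonloops P, j != a & j != b]
  | inr q => jump P a b q end]%SET.

Local Notation rV := 'rV[R]_#|chart_index|.

(** Outside the index set the value is 0, so the exponential gives scale 1 at [a] and [b], as the
    normalization requires. *)
Definition chart_coord (u : rV) (k : 'I_n + 'I_n) : R :=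
  if [pick i | enum_val i == k] is Some i then u ord0 i else 0.

Lemma chart_coord_enum u i : chart_coord u (enum_val i) = u ord0 i.
Proof.
by rewrite /chart_coord; case: pickP => [j /eqP/enum_val_inj ->|/(_ i)] //; rewrite eqxx.
Qed.

Lemma chart_coord_out u k : k \notin chart_index -> chart_coord u k = 0.
Proof.
rewrite /chart_coord; case: pickP => // i /eqP <-.
by rewrite enum_valP.
Qed.

Lemma chart_coord_row (h : 'I_n + 'I_n -> R) k : k \in chart_index ->
  chart_coord (\row_i h (enum_val i)) k = h k.
Proof.
move=> kK; rewrite -[in LHS](enum_rankK_in kK kK) chart_coord_enum mxE.
by rewrite enum_rankK_in.
Qed.

Lemma chart_coord_continuous k : continuous (chart_coord^~ k).
Proof.
rewrite /chart_coord; case: pickP => [i _|_]; first exact: coord_continuous.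
exact: cst_continuous.
Qed.

Definition chart_scale u j : R := expR (chart_coord u (inl j)).
Definition chart_step u q : R := expR (chart_coord u (inr q)).
Definition chart_matrix u := matrix_of P a b (chart_scale u) (chart_step u).

Lemma exp_chart_continuous k : continuous (fun u : rV => expR (chart_coord u k)).
Proof.
move=> u; apply: (@continuous_comp _ _ _ (chart_coord^~ k) (@expR R)).
  exact: chart_coord_continuous.
exact: continuous_expR.
Qed.

Lemma chart_matrix_continuous : continuous chart_matrix.
Proof.
move=> u; apply: mx_continuous_at => k j.
have slopec : continuous (fun u => slope_of P a b (chart_step u) j).
  by apply: sum_continuous => q; exact: exp_chart_continuous.
have scalec : continuous (fun u => chart_scale u j) by exact: exp_chart_continuous.
rewrite (_ : (fun u => _) = fun u => if k == ord0 then if front P b j then chart_scale u j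
  else if tail P b j then - chart_scale u j else 0
  else if front P b j then chart_scale u j * slope_of P a b (chart_step u) j
  else if upright P b j then chart_scale u j else 0); last first.
  by apply/funext => v; rewrite mxE.
case: (k == ord0); case: (front P b j).
- exact: scalec.
- by case: (tail P b j); [apply: continuousN; exact: scalec | exact: cst_continuous].
- by apply: continuousM; [exact: scalec | exact: slopec].
- by case: (upright P b j); [exact: scalec | exact: cst_continuous].
Qed.

Lemma exists_normalized : exists N : 'M[R]_(2, n),
  [/\ N ord0 a = 1, N ord_max a = 0, N ord0 b = 0 & N ord_max b = 1] /\ realizes N P.
Proof.
have [A rA] := P_realizable; have ab := a_lt_b PP abP a_min.
have D0 := realizes_gt0 rA ab abP.
exists (normal_form a b A); split; last exact: realizes_normal_form.
by rewrite !normal_form0 !normal_form1 !minor2ii !mul0r divff // gt_eqF.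
Qed.

Lemma realizes_chart_matrix u : realizes (chart_matrix u) P.
Proof.
have [N [[N0a N1a N0b N1b] rN]] := exists_normalized.
by apply: (realizes_matrix_of PP abP a_min b_max N0a N1a N0b N1b rN) => *; exact: expR_gt0.
Qed.

Lemma P_neq0 : P != finset.set0. Proof. by apply/finset.set0Pn; exists [set a; b]%SET. Qed.

Definition chart_frame u : frame R n :=
  exist _ (chart_matrix u) (mem_set (dim_rowspan_realizes PP P_neq0 (realizes_chart_matrix u))).

Lemma chart_frame_continuous : continuous chart_frame.
Proof. by apply: continuous_comp_initial; exact: chart_matrix_continuous. Qed.

Lemma chart_point_cell u : positroid_cell R P (Gr2_of_frame (chart_frame u)).
Proof. by apply/positroid_cellP; exists (chart_matrix u) => //; exact: realizes_chart_matrix. Qed.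

Definition chart_point u : set_type (positroid_cell R P) :=
  exist _ (Gr2_of_frame (chart_frame u)) (mem_set (chart_point_cell u)).

Lemma chart_point_continuous : continuous chart_point.
Proof.
apply: continuous_comp_initial => u; apply: (@continuous_comp _ _ _ chart_frame).
  exact: chart_frame_continuous.
exact: Gr2_of_frame_continuous.
Qed.

(** The normal form as a function on the Grassmannian: ratios of minors make it independent of the
    spanning matrix and continuous on the cell. *)
Definition ratio_matrix (V : Gr2 R n) : 'M[R]_(2, n) :=
  \matrix_(k, j) if k == ord0 then minor_ratio a b V j b else minor_ratio a b V a j.

Lemma ratio_matrixE V A : rowspan A = sval V -> ratio_matrix V = normal_form a b A.
Proof. by move=> AV; apply/matrixP => k j; rewrite !mxE !(minor_ratioE _ _ _ _ AV); case: ifP. Qed.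

Lemma ratio_matrix_cell V : positroid_cell R P V ->
  [/\ [/\ ratio_matrix V ord0 a = 1, ratio_matrix V ord_max a = 0,
          ratio_matrix V ord0 b = 0 & ratio_matrix V ord_max b = 1],
      realizes (ratio_matrix V) P & rowspan (ratio_matrix V) = sval V].
Proof.
move=> /positroid_cellP[A AV rA]; rewrite (ratio_matrixE AV).
have ab := a_lt_b PP abP a_min; have D0 := realizes_gt0 rA ab abP.
have D1 : minor2 A a b != 0 by rewrite gt_eqF.
split; last by rewrite rowspan_normal_form.
  by rewrite !normal_form0 !normal_form1 !minor2ii !mul0r divff.
exact: realizes_normal_form.
Qed.

Lemma ratio_matrix_continuous V : positroid_cell R P V ->
  forall k j, {for V, continuous (fun V => ratio_matrix V k j : R)}.
Proof.
move=> /positroid_cellP[A AV rA] k j.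
have D0 : exists2 A, rowspan A = sval V & minor2 A a b != 0.
  by exists A => //; rewrite gt_eqF // (realizes_gt0 rA) // (a_lt_b PP abP a_min).
rewrite (_ : (fun V => _) = fun V => if k == ord0 then minor_ratio a b V j b else minor_ratio a b V a j).
  by case: (k == ord0); exact: minor_ratio_continuous.
by apply/funext => W; rewrite mxE.
Qed.

Definition log_coord (V : Gr2 R n) (k : 'I_n + 'I_n) : R := match k with
  | inl j => ln (scale_coord P b (ratio_matrix V) j)
  | inr q => ln (step_coord P a b (ratio_matrix V) q) end.

Definition log_coords V : rV := \row_i log_coord V (enum_val i).

Lemma log_coords_continuous V : positroid_cell R P V -> {for V, continuous log_coords}.
Proof.
move=> cV; have [[N0a N1a N0b N1b] rN NV] := ratio_matrix_cell cV.
have rc := ratio_matrix_continuous cV.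
apply: mx_continuous_at => i0 i; rewrite (_ : (fun V => _) = log_coord^~ (enum_val i)); last first.
  by apply/funext => W; rewrite mxE.
have := enum_valP i; case: (enum_val i) => [j|q]; rewrite inE => H.
  apply: (@continuous_comp _ _ _ (fun V => scale_coord P b (ratio_matrix V) j) (@ln R)).
    rewrite /scale_coord; case: (front P b j); first exact: rc.
    by case: (tail P b j); [apply: continuousN|]; exact: rc.
  apply: continuous_ln; case/and3P: H => jE _ _.
  exact: (scale_coord_gt0 PP a_min b_max N0a N1a N0b N1b rN).
have slopec q' : front P b q' -> {for V, continuous (fun V => slope (ratio_matrix V) q')}.
  move=> fq; apply: (continuousM (rc _ _)).
  apply: (continuousV (s := fun V => ratio_matrix V ord0 q' : R)); last exact: rc.
  by rewrite gt_eqF // (front_N0 PP N0b N1b rN).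
apply: (@continuous_comp _ _ _ (fun V => step_coord P a b (ratio_matrix V) q) (@ln R)).
  have /and3P[fq qa _] := H; have [fp _ _] := prevP PP abP a_min fq qa.
  by apply: continuousB; exact: slopec.
apply: continuous_ln; exact: (step_coord_gt0 PP abP a_min N0b N1b rN).
Qed.

Lemma chart_scale_log V j : positroid_cell R P V -> j \in nonloops P ->
  chart_scale (log_coords V) j = scale_coord P b (ratio_matrix V) j.
Proof.
move=> cV jE; have [[N0a N1a N0b N1b] rN NV] := ratio_matrix_cell cV.
rewrite /chart_scale; have [jK|jK] := boolP (inl j \in chart_index).
  rewrite chart_coord_row //= lnK // posrE.
  exact: (scale_coord_gt0 PP a_min b_max N0a N1a N0b N1b rN).
rewrite chart_coord_out // expR0; move: jK; rewrite inE jE /= negb_and !negbK.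
case/orP => /eqP ->; rewrite /scale_coord; first by rewrite (front_a PP abP a_min).
have ub := upright_b PP abP.
by rewrite (upright_front ub) (upright_tail ub).
Qed.

Lemma chart_matrix_log V : positroid_cell R P V -> chart_matrix (log_coords V) = ratio_matrix V.
Proof.
move=> cV; have [[N0a N1a N0b N1b] rN NV] := ratio_matrix_cell cV.
rewrite -[RHS](matrix_of_coords PP abP a_min b_max N0a N1a N0b N1b rN).
have step_log q : jump P a b q ->
    chart_step (log_coords V) q = step_coord P a b (ratio_matrix V) q.
  move=> jq; rewrite /chart_step chart_coord_row ?inE //= lnK // posrE.
  exact: (step_coord_gt0 PP abP a_min N0b N1b rN).
apply/matrixP => k j; rewrite !mxE.
have -> : slope_of P a b (chart_step (log_coords V)) j =
    slope_of P a b (step_coord P a b (ratio_matrix V)) j.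
  by apply: eq_bigr => q /andP[jq _]; exact: step_log.
have [jE|jE] := boolP (j \in nonloops P); first by rewrite chart_scale_log.
by rewrite /front /upright /tail (negbTE jE).
Qed.

Lemma log_chart_matrix u : log_coords (Gr2_of_frame (chart_frame u)) = u.
Proof.
set V := Gr2_of_frame _.
have [||M0a M1a M0b M1b] := @matrix_of_normal R _ _ _ _ PP abP a_min (chart_scale u) (chart_step u).
- by rewrite /chart_scale chart_coord_out ?expR0 // inE eqxx andbF.
- by rewrite /chart_scale chart_coord_out ?expR0 // inE eqxx !andbF.
have ME : ratio_matrix V = chart_matrix u.
  rewrite (@ratio_matrixE V (chart_matrix u)) //.
  have mab : minor2 (chart_matrix u) a b = 1 by rewrite minor2E M0a M1a M0b M1b; ring.
  apply/matrixP => k j; have [->|->] := row2_cases k.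
    by rewrite normal_form0 mab divr1 minor2E M0b M1b; ring.
  by rewrite normal_form1 mab divr1 minor2E M0a M1a; ring.
apply/rowP => i; rewrite mxE -[RHS]chart_coord_enum.
have := enum_valP i; case: (enum_val i) => [j|q]; rewrite inE /= ME => H.
  by rewrite scale_coord_matrix_of ?expRK //; case/and3P: H.
by rewrite step_coord_matrix_of ?expRK // => *; exact: expR_gt0.
Qed.

Lemma cell_homeomorphic : homeomorphic (set_type (positroid_cell R P)) rV.
Proof.
exists (fun V => log_coords (set_val V)), chart_point; split.
- move=> V; apply: val_inj; apply: val_inj.
  change (rowspan (chart_matrix (log_coords (set_val V))) = sval (set_val V)).
  rewrite chart_matrix_log; last exact: set_valP.
  by have [_ _] := ratio_matrix_cell (set_valP V).
- exact: log_chart_matrix.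
- move=> V; apply: (@continuous_comp _ _ _ set_val log_coords).
    exact: initial_continuous.
  by apply: log_coords_continuous; exact: set_valP.
- exact: chart_point_continuous.
Qed.

(** Invariance of dimension leaves a single candidate for [xget] to return. *)
Lemma positroid_dim_chart : positroid_dim R P = #|chart_index|.
Proof.
apply: xget_unique; first exact: cell_homeomorphic.
by move=> d hd; apply: homeomorphic_rV_dim hd cell_homeomorphic.
Qed.

End Chart.

Local Close Scope classical_set_scope.

(** * Parallel classes and the dimension formula *)

Section Classes.
Variables (n : nat) (P : {set {set 'I_n}}).
Implicit Types i j k l : 'I_n.

Definition parallel i j := [set i; j] \notin P.

Definition parallel_class j := [set i in nonloops P | parallel i j].

Definition parallel_classes := [set parallel_class j | j in nonloops P].

Lemma parallelC i j : parallel i j = parallel j i.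
Proof. by rewrite /parallel finset.setUC. Qed.

Variables (R : realType) (A : 'M[R]_(2, n)).
Hypotheses (PP : P \subset pairs n) (rA : realizes A P).

Lemma parallel_refl i : parallel i i.
Proof. by apply/negP => /(pairs_neq PP); rewrite eqxx. Qed.

Lemma parallelE i j : parallel i j = (minor2 A i j == 0).
Proof. by rewrite (realizes_eq0 _ _ PP rA). Qed.

Lemma nonloop_col_neq0 i : i \in nonloops P -> A ord0 i != 0 \/ A ord_max i != 0.
Proof.
rewrite inE => /existsP[j ijP]; apply/orP; rewrite -negb_and; apply/negP => /andP[/eqP x0 /eqP y0].
by have := realizes_eq0 i j PP rA; rewrite ijP minor2E x0 y0 !mul0r subrr eqxx.
Qed.

Lemma parallel_scale i j : i \in nonloops P -> j \in nonloops P -> parallel i j ->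
  exists2 c : R, c != 0 & forall k : 'I_2, A k j = c * A k i.
Proof.
move=> iE jE; rewrite parallelE minor2E subr_eq0 => /eqP m0.
have [c cE] : exists c, forall k : 'I_2, A k j = c * A k i.
  case: (nonloop_col_neq0 iE) => x0.
    exists (A ord0 j / A ord0 i) => k; have [->|->] := row2_cases k; first by rewrite divfK.
    by rewrite mulrAC [A ord0 j * _]mulrC -m0 mulrAC divff // mul1r.
  exists (A ord_max j / A ord_max i) => k; have [->|->] := row2_cases k; last by rewrite divfK.
  by rewrite mulrAC [A ord_max j * _]mulrC m0 mulrAC divff // mul1r.
exists c => //; apply/eqP => c0.
by case: (nonloop_col_neq0 jE); rewrite cE c0 mul0r eqxx.
Qed.

Lemma minor2_scale i j c w : (forall k : 'I_2, A k j = c * A k i) -> minor2 A j w = c * minor2 A i w.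
Proof. by move=> cE; rewrite !minor2E !cE; ring. Qed.

(** Three vectors of the plane satisfy a linear relation with their minors as coefficients, and a
    nonzero coordinate of column [j] can be cancelled. A loop is parallel to everything, so [j] must
    be a nonloop. *)
Lemma parallel_trans i j k : j \in nonloops P -> parallel i j -> parallel j k -> parallel i k.
Proof.
move=> jE; rewrite !parallelE => /eqP ij /eqP jk.
have e0 : A ord0 j * minor2 A i k = A ord0 i * minor2 A j k + A ord0 k * minor2 A i j.
  by rewrite !minor2E; ring.
have e1 : A ord_max j * minor2 A i k = A ord_max i * minor2 A j k + A ord_max k * minor2 A i j.
  by rewrite !minor2E; ring.
move: e0 e1; rewrite ij jk !mulr0 addr0 => /eqP e0 /eqP e1.
by case: (nonloop_col_neq0 jE) => /negbTE x0; [move: e0 | move: e1]; rewrite mulf_eq0 x0.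
Qed.

Lemma parallel_class_id j : j \in nonloops P -> j \in parallel_class j.
Proof. by move=> jE; rewrite inE jE parallel_refl. Qed.

Lemma eq_parallel_class i j : i \in nonloops P -> j \in nonloops P ->
  (parallel_class i == parallel_class j) = parallel i j.
Proof.
move=> iE jE; apply/eqP/idP => [e|ij].
  by have := parallel_class_id iE; rewrite e inE => /andP[].
apply/setP => k; rewrite [LHS]finset.in_set [RHS]finset.in_set; congr (_ && _).
apply/idP/idP => h; first exact: (parallel_trans iE h ij).
by apply: (parallel_trans jE h); rewrite parallelC.
Qed.

End Classes.

Section Dimension.
Variables (R : realType) (n : nat) (P : {set {set 'I_n}}).
Hypotheses (PP : P \subset pairs n) (P0 : P != finset.set0).
Hypothesis rP : exists A : 'M[R]_(2, n), realizes A P.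

(** The elements [a], [b] and the jumps form a transversal of the parallel classes. *)
Lemma jump_parallel_classes (a b : 'I_n) : [set a; b] \in P ->
  (forall j, j \in nonloops P -> (a <= j)%N) ->
  (forall j, [set a; j] \in P -> (j <= b)%N) ->
  #|parallel_classes P| = (#|[set q | jump P a b q]| + 2)%N.
Proof.
move=> abP a_min b_max; have [A rA] := rP.
have [N [[N0a N1a N0b N1b] rN]] := exists_normalized PP abP a_min rP.
have [aE bE] := nonloopsP abP.
pose reps := a |: (b |: [set q | jump P a b q]).
have jumpE q : jump P a b q -> q \in nonloops P by case/and3P => /and3P[].
have repsE : {subset reps <= nonloops P}.
  move=> j; rewrite finset.in_setU1 finset.in_setU1 finset.in_set.
  by case/or3P => [/eqP ->|/eqP ->|/jumpE].
have jumpa q : jump P a b q -> [set a; q] \in P.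
  move=> jq; have qE := jumpE q jq; case/and3P: jq => _ qa /forallP/(_ a).
  by rewrite aE /= ltn_neqAle eq_sym qa a_min.
have jumpb q : jump P a b q -> [set q; b] \in P by case/and3P => /and3P[].
have jumpj q q' : jump P a b q -> jump P a b q' -> (q < q')%N -> [set q; q'] \in P.
  by move=> jq /and3P[_ _ /forallP/(_ q)]; rewrite (jumpE q jq) => /implyP.
have repsP i j : i \in reps -> j \in reps -> i != j -> [set i; j] \in P.
  rewrite !inE => /or3P[/eqP ->|/eqP ->|ji] /or3P[/eqP ->|/eqP ->|jj]; rewrite ?eqxx // => ij.
  - exact: jumpa.
  - by rewrite finset.setUC.
  - by rewrite finset.setUC; exact: jumpb.
  - by rewrite finset.setUC; exact: jumpa.
  - exact: jumpb.
  - case: (ltngtP i j) => lt; [exact: jumpj|rewrite finset.setUC; exact: jumpj|].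
    by move: ij; rewrite (val_inj lt) eqxx.
have inj : {in reps &, injective (parallel_class P)}.
  move=> i j ir jr /eqP; rewrite (eq_parallel_class PP rA) ?repsE // => pij.
  by apply/eqP; apply: contraNT pij => /(repsP _ _ ir jr).
have -> : parallel_classes P = [set parallel_class P j | j in reps].
  apply/eqP; rewrite finset.eqEsubset; apply/andP; split; apply/fintype.subsetP => X.
    move=> /imsetP[j jE ->].
    suff [i ir ij] : exists2 i, i \in reps & parallel P j i.
      apply/imsetP; exists i => //; apply/eqP; rewrite (eq_parallel_class PP rA) //; exact: repsE.
    have /or3P[fj|uj|tj] := nonloop_cases b jE.
    (* The least nonloop parallel to a front element is either [a] or a jump. *)
    - have ex : exists i : nat, [exists k, [&& (k : 'I_n) == i :> nat, k \in nonloops P & parallel P k j]].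
        by exists j; apply/existsP; exists j; rewrite eqxx jE (parallel_refl PP).
      have [m0 /existsP[i /and3P[/eqP im iE ij]] mmin] := ex_minnP ex.
      have mi k : k \in nonloops P -> parallel P k j -> (i <= k)%N.
        by move=> kE kj; rewrite im; apply: mmin; apply/existsP; exists k; rewrite eqxx kE.
      exists i; last by rewrite parallelC.
      rewrite !inE; case: eqP => //= /eqP ia.
      have fi : front P b i.
        have := mi j jE (parallel_refl PP j); rewrite leq_eqVlt => /orP[/eqP/val_inj -> //|lt].
        exact: (parallel_front PP a_min N0a N1a N0b N1b rN fj lt iE ij).
      rewrite /jump fi ia; apply/orP; right; apply/forallP => k; apply/implyP => /andP[kE ki].
      apply: contraT => kpi; have := mi k kE (parallel_trans PP rA iE kpi ij).
      by rewrite leqNgt ki.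
    - by exists b; [rewrite !inE eqxx orbT | case/and3P: uj].
    - exists a; first by rewrite !inE eqxx.
      rewrite parallelC; apply/negP => /b_max; rewrite leqNgt.
      by case/andP: tj => _ ->.
  by move=> /imsetP[j jr ->]; apply/imsetP; exists j => //; exact: repsE.
rewrite card_in_imset // !cardsU1 !inE.
have ab : (a < b)%N := a_lt_b PP abP a_min.
have -> : (a == b) = false by rewrite -val_eqE /= ltn_eqF.
rewrite [jump P a b a](_ : _ = false) /=; last by rewrite /jump eqxx andbF.
rewrite [jump P a b b](_ : _ = false) ?addn1 ?addn2 //=.
by rewrite /jump /front (negbTE (parallel_refl PP b)) !andbF.
Qed.

Lemma positroid_dimE :
  (positroid_dim R P + 4 = #|nonloops P| + #|parallel_classes P|)%N.
Proof.
have [I IP] := finset.set0Pn _ P0.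
have := fintype.subsetP PP _ IP; rewrite /pairs inE => /cards2P[i0 [j0 [_ IE]]].
rewrite {}IE in IP; have [iE _] := nonloopsP IP.
(* These extremal choices produce the sign pattern of the chart: no nonloop before [a], and after
   [b] only parallels of [a]. *)
pose a := [arg min_(i < i0 in nonloops P) (i : nat)]%N.
have [aE a_min] : a \in nonloops P /\ forall j, j \in nonloops P -> (a <= j)%N.
  by rewrite /a; case: arg_minnP.
have [b0 ab0] : exists b0, [set a; b0] \in P by move: aE; rewrite inE => /existsP.
pose b := [arg max_(i > b0 | [set a; i] \in P) (i : nat)]%N.
have [abP b_max] : [set a; b] \in P /\ forall j, [set a; j] \in P -> (j <= b)%N.
  by rewrite /b; case: arg_maxnP.
rewrite (positroid_dim_chart PP abP a_min b_max rP) (jump_parallel_classes abP a_min b_max).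
have -> : chart_index P a b =
    [set inl j | j in nonloops P :\ a :\ b] :|: [set inr q | q in [set q | jump P a b q]].
  apply/setP => -[j|q]; rewrite [LHS]inE finset.in_setU.
    have -> : (inl j \in [set inr q | q in [set q | jump P a b q]]) = false by apply/imsetP => -[].
    rewrite (finset.mem_imset _ _ (@inl_inj 'I_n 'I_n)) orbF in_setD1 in_setD1.
    by case: (j == a); case: (j == b); rewrite ?andbF ?andbT.
  have -> : (inr q \in [set inl j | j in nonloops P :\ a :\ b]) = false by apply/imsetP => -[].
  by rewrite (finset.mem_imset _ _ (@inr_inj 'I_n 'I_n)) finset.in_set.
rewrite cardsU (_ : _ :&: _ = finset.set0) ?cards0 ?subn0; last first.
  apply/setP => -[j|q]; rewrite !inE; apply/andP => -[/imsetP[x _ e1] /imsetP[y _ e2]] //.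
rewrite !card_imset; [|exact: inr_inj|exact: inl_inj].
have ab : (a < b)%N := a_lt_b PP abP a_min.
have bE : b \in nonloops P :\ a.
  by rewrite in_setD1 (nonloopsP abP).2 andbT -val_eqE /= neq_ltn ab orbT.
have := cardsD1 a (nonloops P); have := cardsD1 b (nonloops P :\ a); rewrite aE bE.
lia.
Qed.

End Dimension.

(** * Facets *)

Section FinsetFacts.

(** Removing either element of a colliding pair makes [f] injective, so every collision involves
    both [x] and [y]. *)
Lemma card_imset_collapse (T T' : finType) (f : T -> T') (S : {set T}) :
  (#|f @: S| + 1 = #|S|)%N ->
  exists x y, [/\ x \in S, y \in S, x != y, f x = f y &
    forall u v, u \in S -> v \in S -> u != v -> f u = f v -> (u == x) && (v == y) || (u == y) && (v == x)].
Proof.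
move=> cS.
have /dinjectivePn[x xS [y /andP[yx yS] fxy]] : ~~ dinjectiveb f (mem S).
  apply/negP => /dinjectiveP fi; have := card_in_imset (fi : {in S &, injective f}); lia.
have {}yx : y != x by exact: yx.
have inj z z' : z \in S -> z' \in S -> z != z' -> f z = f z' -> {in S :\ z &, injective f}.
  move=> zS z'S zz' fzz'; apply/imset_injP; rewrite (_ : f @: (S :\ z) = f @: S).
    by have := cardsD1 z S; rewrite zS; lia.
  apply/eqP; rewrite finset.eqEsubset imsetS ?finset.subD1set //=.
  apply/fintype.subsetP => _ /imsetP[u uS ->]; have [->|uz] := eqVneq u z.
    by rewrite fzz' imset_f // in_setD1 eq_sym zz'.
  by rewrite imset_f // in_setD1 uz.
exists x, y; split=> // [|u v uS vS uv fuv]; first by rewrite eq_sym.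
have Hy : (u == y) || (v == y).
  apply: contraT; rewrite negb_or => /andP[uy vy]; case/eqP: uv.
  by apply: (inj y x) => //; rewrite in_setD1 ?uy ?vy.
have Hx : (u == x) || (v == x).
  apply: contraT; rewrite negb_or => /andP[ux vx]; case/eqP: uv.
  by apply: (inj x y) => //; rewrite 1?eq_sym ?in_setD1 ?ux ?vx.
move: yx; case/orP: Hx => /eqP <-; case/orP: Hy => /eqP <-; rewrite ?eqxx ?andbT ?orbT //.
Qed.

Lemma cardsD1_in (T : finType) (S : {set T}) x : x \in S -> (#|S :\ x| + 1)%N = #|S|.
Proof. by move=> xS; rewrite (cardsD1 x S) xS addnC. Qed.

Lemma set2_inj (T : finType) (x y u v : T) : [set x; y] = [set u; v] ->
  (x = u /\ y = v) \/ (x = v /\ y = u).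
Proof.
move=> e; have xuv : x \in [set u; v] by rewrite -e set21.
have yuv : y \in [set u; v] by rewrite -e set22.
have uxy : u \in [set x; y] by rewrite e set21.
have vxy : v \in [set x; y] by rewrite e set22.
move: xuv yuv uxy vxy; rewrite !finset.in_set2.
case/orP => /eqP ->; case/orP => /eqP ->; rewrite ?orbb; [|by left|by right|].
  by move=> _ /eqP ->; left.
by move=> /eqP -> _; left.
Qed.

End FinsetFacts.

Section Pairs.
Variable n : nat.
Implicit Types (i j k l w : 'I_n) (P Q D : {set {set 'I_n}}) (X Y : {set 'I_n}).

Lemma in_pairs i j : ([set i; j] \in pairs n) = (i != j).
Proof. by rewrite /pairs inE cards2; case: (i != j). Qed.

Lemma eq_pair_sets P Q : P \subset pairs n -> Q \subset pairs n ->
  (forall i j, i != j -> ([set i; j] \in P) = ([set i; j] \in Q)) -> P = Q.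
Proof.
move=> /fintype.subsetP PP /fintype.subsetP QP H; apply/setP => I.
have [IP|] := boolP (I \in pairs n).
  have := IP; rewrite /pairs inE => /cards2P[i [j [ij ->]]]; exact: H.
by move=> nI; rewrite (contraNF (PP I) nI) (contraNF (QP I) nI).
Qed.

Lemma in_cross_pairs X Y i j : ([set i; j] \in cross_pairs X Y) =
  (i \in X) && (j \in Y) || (j \in X) && (i \in Y).
Proof.
apply/imset2P/orP => [[x y xX yY /set2_inj[[-> ->]|[-> ->]]]|[]/andP[iX jY]].
- by left; rewrite xX.
- by right; rewrite xX.
- by exists i j.
- by exists j i => //; rewrite finset.setUC.
Qed.

Lemma in_add_full D j i k : i != k ->
  ([set i; k] \in add_full D j) = [|| [set i; k] \in D, i == j | k == j].
Proof.
move=> ik; rewrite finset.in_setU; congr (_ || _); apply/imsetP/orP => [[l lj]|].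
  by move=> /set2_inj[[-> _]|[_ ->]]; rewrite eqxx; [left|right].
move=> [/eqP ij|/eqP kj]; subst.
  by exists k => //; rewrite !inE eq_sym.
by exists i; rewrite ?inE // finset.setUC.
Qed.

Lemma in_pairsC D i j : ([set i; j] \in pairsC D) = (i != j) && ([set i; j] \notin D).
Proof. by rewrite finset.in_setD in_pairs andbC. Qed.

Lemma pairsC_sub D : pairsC D \subset pairs n.
Proof. exact: finset.subsetDl. Qed.

(** The second alternative is the wrap from the largest element to the least; it also covers a
    singleton [V]. *)
Definition cyclic_next (V : {set 'I_n}) i j := j \in V /\
  (((i < j)%N /\ forall w, w \in V -> (w <= i)%N || (j <= w)%N) \/
   forall w, w \in V -> (j <= w <= i)%N).

Lemma enum_sorted (V : {set 'I_n}) : sorted (fun i j => (i < j)%N) (enum V).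
Proof.
rewrite /enum_mem; apply: sorted_filter; first by move=> ? ? ?; apply: ltn_trans.
have := iota_ltn_sorted 0 n; rewrite -val_enum_ord sorted_map -enumT; exact.
Qed.

Lemma next_enumP (V : {set 'I_n}) i : i \in V -> cyclic_next V i (next (enum V) i).
Proof.
move=> iV; set s := enum V.
have tr : transitive (fun i j : 'I_n => (i < j)%N) by move=> ? ? ?; apply: ltn_trans.
have is_ : i \in s by rewrite mem_enum.
have nth_lt x y : (x < y)%N -> (y < size s)%N -> (nth i s x < nth i s y)%N.
  move=> xy ys; apply: (@sorted_ltn_nth _ _ tr i s (enum_sorted V)) => //.
  exact: ltn_trans xy ys.
have nth_le x y : (x <= y)%N -> (y < size s)%N -> (nth i s x <= nth i s y)%N.
  by rewrite leq_eqVlt => /orP[/eqP -> //|xy] ys; apply: ltnW; exact: nth_lt.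
have ix : (index i s < size s)%N by rewrite index_mem.
have idx w : w \in V -> nth i s (index w s) = w /\ (index w s < size s)%N.
  by move=> wV; rewrite nth_index ?index_mem ?mem_enum.
have [E|E] : (index i s).+1 = size s \/ ((index i s).+1 < size s)%N by lia.
  have -> : next s i = nth i s 0.
    rewrite next_nth is_; case: s is_ ix E nth_lt nth_le idx => // y p _ ix E _ _ _.
    by rewrite nth_default //=; move: E => /= [->].
  split; first by rewrite -(mem_enum (mem V)) mem_nth // (leq_ltn_trans (leq0n _) ix).
  right=> w wV; have [we ws] := idx w wV.
  have [ie _] := idx i iV; rewrite -we -{4}ie; apply/andP; split; apply: nth_le => //; lia.
have -> : next s i = nth i s (index i s).+1.
  rewrite next_nth is_; case: s is_ ix E nth_lt nth_le idx => // y p _ ix E _ _ _ /=.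
  by apply: set_nth_default; move: E; rewrite /= ltnS.
split; first by rewrite -(mem_enum (mem V)) mem_nth.
left; have [ie _] := idx i iV; split; first by rewrite -{1}ie nth_lt.
move=> w wV; have [we ws] := idx w wV; have [le|gt] := leqP (index w s) (index i s).
  by rewrite -we -{2}ie nth_le.
by rewrite -we nth_le ?orbT.
Qed.

End Pairs.

Lemma in_parallel_class n (P : {set {set 'I_n}}) (i j : 'I_n) :
  (i \in parallel_class P j) = (i \in nonloops P) && parallel P i j.
Proof. by rewrite /parallel_class finset.in_set. Qed.

(** * Matrices realizing deletions and merges, and the obstruction to other merges *)

Section Realizability.
Variables (R : realType) (n : nat).
Implicit Types (i j k l w : 'I_n) (P Q : {set {set 'I_n}}) (A : 'M[R]_(2, n)).

Lemma positroid_realizes P : positroid R P <->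
  [/\ P \subset pairs n, P != finset.set0 & exists A, realizes A P].
Proof.
split=> [[PP P0 [V /positroid_cellP[A _ rA]]]|[PP P0 [A rA]]]; first by split=> //; exists A.
split=> //; exists (exist _ (rowspan A) (dim_rowspan_realizes PP P0 rA)).
by apply/positroid_cellP; exists A.
Qed.

Lemma delete_realizable Q A j : realizes A Q ->
  realizes (\matrix_(k, l) (if l == j then 0 else A k l)) [set I in Q | j \notin I].
Proof.
move=> rA i l il; rewrite minor2E !mxE finset.in_set in_set2 negb_or ![j == _]eq_sym.
case: eqP => [_|_]; first by rewrite /= andbF !mul0r subrr.
case: eqP => [_|_]; first by rewrite /= andbF !mulr0 subrr.
by rewrite !andbT -minor2E; exact: rA.
Qed.

(** Every column parallel to [a] is turned onto the line of column [b], keeping its ratio to column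
    [a]. No nonloop lies between [a] and [b], so no minor with a third class changes sign. *)
Lemma merge_realizable Q A a b : Q \subset pairs n -> realizes A Q ->
  a \in nonloops Q -> cyclic_next (nonloops Q) a b -> [set a; b] \in Q ->
  exists A', realizes A' (Q :\: cross_pairs (parallel_class Q a) (parallel_class Q b)).
Proof.
move=> QP rA aE [bE next_ab] abQ.
set X := parallel_class Q a; set Y := parallel_class Q b.
(* If the step from [a] to [b] wraps around, column [a] is turned onto the opposite of column
   [b]. *)
pose eta : R := if (a < b)%N then 1 else -1.
pose lam l : R := minor2 A l b / minor2 A a b.
have mab0 : minor2 A a b != 0 by rewrite (realizes_eq0 _ _ QP rA) negbK.
have lamE l (k : 'I_2) : l \in X -> A k l = lam l * A k a.
  rewrite in_parallel_class => /andP[lE la].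
  have [c c0 cE] := parallel_scale QP rA aE lE (etrans (parallelC _ _ _) la).
  by rewrite /lam (minor2_scale _ cE) mulfK.
pose A' : 'M[R]_(2, n) := \matrix_(k, l) (if l \in X then lam l * eta * A k b else A k l).
have side w : w \in nonloops Q -> w \notin X -> w \notin Y ->
    0 < eta * minor2 A b w * minor2 A a w.
  move=> wE wX wY.
  have awQ : [set a; w] \in Q.
    by move: wX; rewrite in_parallel_class wE /= negbK finset.setUC.
  have bwQ : [set b; w] \in Q.
    by move: wY; rewrite in_parallel_class wE /= negbK finset.setUC.
  have sa := realizes_sign QP rA awQ; have sb := realizes_sign QP rA bwQ.
  have a0 : minor2 A a w != 0 by rewrite (realizes_eq0 _ _ QP rA) negbK.
  have b0 : minor2 A b w != 0 by rewrite (realizes_eq0 _ _ QP rA) negbK.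
  have aw : (w : nat) != a by have := pairs_neq QP awQ; rewrite eq_sym.
  have bw : (w : nat) != b by have := pairs_neq QP bwQ; rewrite eq_sym.
  case: next_ab => [[ab /(_ w wE) ww]|/(_ w wE) ww].
    have e : (a < w)%N = (b < w)%N by move: ab ww aw bw; clear; lia.
    rewrite /eta ab mul1r; case: (ltP 0 (minor2 A a w)) => [a1|a1].
      by rewrite pmulr_lgt0 // sb -e -sa.
    have a2 : minor2 A a w < 0 by rewrite lt_neqAle a0.
    have b2 : minor2 A b w < 0 by rewrite lt_neqAle b0 leNgt sb -e -sa -leNgt.
    by rewrite nmulr_lgt0.
  case/andP: ww => bw' wa.
  have bw1 : (b < w)%N by rewrite ltn_neqAle eq_sym bw.
  have aw1 : (a < w)%N = false by rewrite ltnNge wa.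
  have ab : (a < b)%N = false by rewrite ltnNge (leq_trans bw').
  have a2 : minor2 A a w < 0 by rewrite lt_neqAle a0 leNgt sa aw1.
  by rewrite /eta ab mulN1r mulNr oppr_gt0 pmulr_rlt0 // sb.
have minorX i j : i \in X -> j \notin X -> minor2 A' i j = lam i * eta * minor2 A b j.
  by move=> iX /negbTE jX; rewrite !minor2E !mxE iX jX; ring.
have signX i j : i \in X -> j \notin X ->
    if [set i; j] \in Q :\: cross_pairs X Y then 0 < minor2 A' i j * minor2 A i j
    else minor2 A' i j == 0.
  move=> iX jX; rewrite finset.in_setD in_cross_pairs iX (negbTE jX) /= orbF minorX //.
  have mij : minor2 A i j = lam i * minor2 A a j by apply: minor2_scale => k; exact: lamE.
  have [jE|jE] := boolP (j \in nonloops Q); last first.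
    have -> : ([set i; j] \in Q) = false by apply/negP => /nonloopsP[_]; apply/negP.
    have -> : minor2 A b j = 0.
      by apply/eqP; rewrite (realizes_eq0 _ _ QP rA); apply/negP => /nonloopsP[_]; apply/negP.
    by rewrite andbF mulr0 eqxx.
  have [jY|jY] := boolP (j \in Y).
    have -> : minor2 A b j = 0.
      apply/eqP; rewrite (realizes_eq0 _ _ QP rA) finset.setUC.
      by move: jY; rewrite in_parallel_class => /andP[].
    by rewrite mulr0 eqxx.
  have ijQ : [set i; j] \in Q.
    apply: contraT => ijQ; move: jX; rewrite in_parallel_class jE /=.
    rewrite (_ : parallel Q j a) //.
    have iX' := iX; rewrite in_parallel_class in iX'; case/andP: iX' => iE ia.
    by apply: (parallel_trans QP rA iE _ ia); rewrite parallelC.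
  rewrite ijQ mij /=.
  have l0 : lam i != 0.
    apply: contraTneq ijQ => l0; rewrite -(realizes_eq0 _ _ QP rA) mij l0 mul0r //.
  (* The sign of [lam i] is unknown, but it enters both minors and is squared away. *)
  have -> : lam i * eta * minor2 A b j * (lam i * minor2 A a j) =
    lam i ^+ 2 * (eta * minor2 A b j * minor2 A a j) by ring.
  by rewrite mulr_gt0 ?side // exprn_even_gt0.
exists A' => i j ij.
have [iX|iX] := boolP (i \in X); have [jX|jX] := boolP (j \in X).
- have -> : ([set i; j] \in Q :\: cross_pairs X Y) = false.
    apply/negP; rewrite finset.in_setD => /andP[_]; apply/negP.
    move: iX jX; rewrite !in_parallel_class => /andP[iE ia] /andP[jE ja].
    by apply: (parallel_trans QP rA aE ia); rewrite parallelC.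
  by rewrite minor2E !mxE iX jX; apply/eqP; ring.
- have := signX i j iX jX; case: ifP => //; rewrite finset.in_setD => /andP[_ ijQ].
  by rewrite pmulr_lgt0 // (realizes_gt0 rA).
- have := signX j i jX iX; rewrite finset.setUC minor2C [minor2 A j i]minor2C mulrNN oppr_eq0.
  case: ifP => //; rewrite finset.in_setD => /andP[_ ijQ].
  by rewrite pmulr_lgt0 // (realizes_gt0 rA).
- rewrite finset.in_setD in_cross_pairs (negbTE iX) (negbTE jX) /= minor2E !mxE.
  by rewrite (negbTE iX) (negbTE jX) -minor2E; exact: rA.
Qed.

(* Positivity forbids a parallel pair [a, c] separating [b, d], which are the
   successors of [a] and [c]. *)
Lemma no_crossing Q P A a b c d : P \subset pairs n -> realizes A P ->
  nonloops P = nonloops Q -> a \in nonloops P -> c \in nonloops P -> a != c ->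
  cyclic_next (nonloops Q) a b -> cyclic_next (nonloops Q) c d ->
  parallel P a c -> [set a; b] \in P -> [set c; b] \in P ->
  [set a; d] \in P -> [set c; d] \in P -> False.
Proof.
move=> PP rA EE aE cE ac [bE nab] [dE ncd] pac ab cb ad cd.
have [x x0 xE] := parallel_scale PP rA aE cE pac.
have sab := realizes_sign PP rA ab; have sad := realizes_sign PP rA ad.
have scb := realizes_sign PP rA cb; have scd := realizes_sign PP rA cd.
rewrite !(minor2_scale _ xE) in scb scd.
have b0 : minor2 A a b != 0 by rewrite (realizes_eq0 _ _ PP rA) negbK.
have d0 : minor2 A a d != 0 by rewrite (realizes_eq0 _ _ PP rA) negbK.
(* Column [c] is [x] times column [a], so for [b] and for [d] the sign of [x] alone decides whether
   the minors with [a] and [c] agree in sign: [a] and [c] do not separate [b] from [d]. *)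
have key : ((c < b) == (a < b))%N = ((c < d) == (a < d))%N.
  rewrite -sab -sad -scb -scd; case: (ltP 0 x) => x1.
    by rewrite !pmulr_rgt0 // !eqxx.
  have x2 : x < 0 by rewrite lt_neqAle x0.
  have sg (y : R) : y != 0 -> ((y < 0) == (0 < y)) = false.
    by case: (ltgtP y 0) => // ->; rewrite eqxx.
  by rewrite !nmulr_rgt0 // !sg.
have {}ac : (a : nat) != c by [].
have := pairs_neq PP ab; have := pairs_neq PP cb; have := pairs_neq PP ad; have := pairs_neq PP cd.
rewrite -!val_eqE /= => cd' ad' cb' ab'; rewrite EE in aE cE.
case: nab => [[lt_ab wab]|wab]; case: ncd => [[lt_cd wcd]|wcd];
  have := wab c cE; have := wab d dE; have := wcd a aE; have := wcd b bE;
  [move: lt_ab lt_cd|move: lt_ab|move: lt_cd|];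
  move: key ac cd' ad' cb' ab'; clear; lia.
Qed.

End Realizability.

(** * Parallel classes of a smaller positroid *)

Section Comparison.
Variables (R : realType) (n : nat) (P Q : {set {set 'I_n}}).
Implicit Types (i j k l : 'I_n) (X Y : {set 'I_n}).
Variables (A B : 'M[R]_(2, n)).
Hypotheses (QP : Q \subset pairs n) (PQ : P \subset Q) (rA : realizes A P) (rB : realizes B Q).

Let PP : P \subset pairs n := fintype.subset_trans PQ QP.

Lemma nonloops_sub : nonloops P \subset nonloops Q.
Proof.
apply/fintype.subsetP => i; rewrite !finset.in_set => /existsP[j ijP].
by apply/existsP; exists j; apply: (fintype.subsetP PQ).
Qed.

Lemma parallel_sub i j : parallel Q i j -> parallel P i j.
Proof. by apply: contra; apply: (fintype.subsetP PQ). Qed.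

(** The class of [P] that absorbs the class [X] of [Q]. Only elements of [X] that remain nonloops
    count, since a loop is parallel to everything. *)
Definition coarsen X : {set 'I_n} :=
  [set l in nonloops P | [exists i in X, (i \in nonloops P) && parallel P l i]].

Lemma coarsen_class i : i \in nonloops P -> coarsen (parallel_class Q i) = parallel_class P i.
Proof.
move=> iE; apply/setP => l; rewrite [LHS]finset.in_set in_parallel_class; congr (_ && _).
have iQ := fintype.subsetP nonloops_sub i iE.
apply/existsP/idP => [[k /and3P[]]|li]; last first.
  by exists i; rewrite iE li (parallel_class_id QP).
rewrite in_parallel_class => /andP[_ ki] kE lk.
exact: (parallel_trans PP rA kE lk (parallel_sub ki)).
Qed.

Definition surviving_classes := [set parallel_class Q i | i in nonloops P].

Lemma coarsen_surviving : coarsen @: surviving_classes = parallel_classes P.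
Proof.
rewrite /surviving_classes -imset_comp; apply: eq_in_imset => i iE.
exact: coarsen_class.
Qed.

Lemma surviving_sub : surviving_classes \subset parallel_classes Q.
Proof. by apply: imsetS; exact: nonloops_sub. Qed.

Lemma card_parallel_classes_le : (#|parallel_classes P| <= #|surviving_classes|)%N.
Proof. by rewrite -coarsen_surviving leq_imset_card. Qed.

Lemma eq_coarsen i j : i \in nonloops P -> j \in nonloops P ->
  (coarsen (parallel_class Q i) == coarsen (parallel_class Q j)) = parallel P i j.
Proof. by move=> iE jE; rewrite !coarsen_class // (eq_parallel_class PP rA). Qed.

End Comparison.

Section ClassFacts.
Variables (R : realType) (n : nat) (Q : {set {set 'I_n}}) (B : 'M[R]_(2, n)).
Implicit Types (i j k l : 'I_n) (X Y : {set 'I_n}).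
Hypotheses (QP : Q \subset pairs n) (rB : realizes B Q).

Lemma parallel_classesP X i : X \in parallel_classes Q -> i \in X ->
  i \in nonloops Q /\ X = parallel_class Q i.
Proof.
move=> /imsetP[j jE ->]; rewrite in_parallel_class => /andP[iE ij]; split=> //.
by apply/eqP; rewrite (eq_parallel_class QP rB) // parallelC.
Qed.

Lemma parallel_classes_neq0 X : X \in parallel_classes Q -> exists i, i \in X.
Proof. by move=> /imsetP[j jE ->]; exists j; exact: (parallel_class_id QP). Qed.

Lemma parallel_classes_inj X Y i : X \in parallel_classes Q -> Y \in parallel_classes Q ->
  i \in X -> i \in Y -> X = Y.
Proof. by move=> XC YC /(parallel_classesP XC)[_ ->] /(parallel_classesP YC)[_ ->]. Qed.

Lemma distinct_classes_pair X Y i j : X \in parallel_classes Q -> Y \in parallel_classes Q ->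
  X != Y -> i \in X -> j \in Y -> [set i; j] \in Q.
Proof.
move=> XC YC XY /(parallel_classesP XC)[iE Xi] /(parallel_classesP YC)[jE Yj].
by move: XY; rewrite Xi Yj (eq_parallel_class QP rB) // negbK.
Qed.

Lemma same_class_parallel X i j : X \in parallel_classes Q -> i \in X -> j \in X ->
  [set i; j] \notin Q.
Proof.
move=> XC /(parallel_classesP XC)[_ ->]; rewrite in_parallel_class => /andP[_].
by rewrite parallelC.
Qed.

End ClassFacts.

Section CodimensionOne.
Variables (R : realType) (n : nat) (P Q : {set {set 'I_n}}).
Implicit Types (i j k l : 'I_n) (X Y : {set 'I_n}).
Variables (A B : 'M[R]_(2, n)).
Hypotheses (QP : Q \subset pairs n) (PQ : P \subset Q) (rA : realizes A P) (rB : realizes B Q).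

Let PP : P \subset pairs n := fintype.subset_trans PQ QP.

Let class_in i : i \in nonloops Q -> parallel_class Q i \in parallel_classes Q.
Proof. by move=> iE; apply/imsetP; exists i. Qed.

(** Since [coarsen] loses exactly one class, it identifies a single pair of classes, and the pairs
    that vanish are those between the two. *)
Lemma merged_pair : nonloops P = nonloops Q ->
  (#|parallel_classes P| + 1 = #|parallel_classes Q|)%N ->
  exists X Y, [/\ X \in parallel_classes Q, Y \in parallel_classes Q, X != Y &
    P = Q :\: cross_pairs X Y].
Proof.
move=> EE cc; have surv : surviving_classes P Q = parallel_classes Q.
  by rewrite /surviving_classes EE.
have := card_imset_collapse (f := coarsen P) (S := parallel_classes Q).
rewrite -{1}surv (coarsen_surviving QP PQ rA) => /(_ cc)[X [Y [XC YC XY hXY H]]].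
exists X, Y; split=> //; apply: eq_pair_sets => //.
  exact: fintype.subset_trans (finset.subsetDl _ _) QP.
move=> i j ij; rewrite finset.in_setD in_cross_pairs.
have hpar k l : k \in X -> l \in Y -> [set k; l] \notin P.
  move=> kX lY; have [kE Xk] := parallel_classesP QP rB XC kX.
  have [lE Yl] := parallel_classesP QP rB YC lY.
  by rewrite -[_ \notin _](eq_coarsen QP PQ rA) ?EE // -Xk -Yl hXY.
have [ijP|ijP] := boolP ([set i; j] \in P).
  rewrite (fintype.subsetP PQ _ ijP) andbT; apply/esym/norP; split; apply/negP => /andP[iX jY].
    by have := hpar _ _ iX jY; rewrite ijP.
  by have := hpar _ _ iX jY; rewrite finset.setUC ijP.
apply/esym/negbTE; rewrite negb_and negbK; case: (boolP (_ \in Q)); rewrite ?orbT // orbF => ijQ.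
have [iE jE] := nonloopsP ijQ.
have := H _ _ (class_in iE) (class_in jE).
rewrite (eq_parallel_class QP rB) // /parallel negbK => /(_ ijQ).
have /eqP -> : coarsen P (parallel_class Q i) == coarsen P (parallel_class Q j).
  by rewrite (eq_coarsen QP PQ rA) ?EE.
move=> /(_ erefl); case/orP => /andP[/eqP <- /eqP <-].
  by rewrite !(parallel_class_id QP).
by rewrite !(parallel_class_id QP) // orbT.
Qed.

(** With equally many classes, every class of [Q] survives and [coarsen] is injective. Hence the
    lost nonloop has a companion in its class, and only its own pairs vanish. *)
Lemma deleted_element : (#|nonloops P| + 1 = #|nonloops Q|)%N ->
  #|parallel_classes P| = #|parallel_classes Q| ->
  exists j, [/\ j \in nonloops Q, (1 < #|parallel_class Q j|)%N & P = [set I in Q | j \notin I]].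
Proof.
move=> kk cc.
have EE : nonloops P \subset nonloops Q := nonloops_sub PQ.
have [j jE EPE] : exists2 j, j \in nonloops Q & nonloops P = nonloops Q :\ j.
  have [j [jQ jP]] : exists j, j \in nonloops Q /\ j \notin nonloops P.
    have : nonloops Q :\: nonloops P != finset.set0.
      by rewrite -card_gt0 cardsD (finset.setIidPr EE); lia.
    by case/finset.set0Pn => j; rewrite finset.in_setD => /andP[jP jQ]; exists j.
  exists j => //; apply/eqP; rewrite eqEcard; apply/andP; split.
    apply/fintype.subsetP => i iE; rewrite in_setD1 (fintype.subsetP EE _ iE) andbT.
    by apply: contraNneq jP => <-.
  by rewrite -(leq_add2r 1) kk cardsD1_in.
have c1 := card_parallel_classes_le QP PQ rA.
have surv : surviving_classes P Q = parallel_classes Q.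
  by apply/eqP; rewrite eqEcard surviving_sub //= -cc.
have inj : {in parallel_classes Q &, injective (coarsen P)}.
  by apply/imset_injP; rewrite -surv (coarsen_surviving QP PQ rA) surv cc.
exists j; split=> //.
  have : parallel_class Q j \in surviving_classes P Q by rewrite surv class_in.
  case/imsetP => i; rewrite EPE in_setD1 => /andP[ij iE] e.
  have ji : j \in parallel_class Q i by rewrite -e (parallel_class_id QP).
  have : [set j; i] \subset parallel_class Q j.
    apply/fintype.subsetP => x; rewrite finset.in_set2 e => /orP[]/eqP -> //.
    exact: (parallel_class_id QP).
  by move=> /subset_leq_card; rewrite cards2 eq_sym ij.
apply: eq_pair_sets => //.
  by apply: fintype.subset_trans QP; apply/fintype.subsetP => I; rewrite finset.in_set => /andP[].
move=> k l kl; rewrite finset.in_set in_set2 negb_or.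
apply/idP/and3P => [klP|[klQ jk jl]].
  have [kE lE] := nonloopsP klP; split; first exact: (fintype.subsetP PQ).
    by move: kE; rewrite EPE in_setD1 eq_sym => /andP[].
  by move: lE; rewrite EPE in_setD1 eq_sym => /andP[].
have [kE lE] := nonloopsP klQ.
have kP : k \in nonloops P by rewrite EPE in_setD1 eq_sym jk.
have lP : l \in nonloops P by rewrite EPE in_setD1 eq_sym jl.
apply: contraLR klQ => klP; rewrite -[_ \notin _](eq_parallel_class QP rB) //.
by apply/eqP/inj; rewrite ?class_in //; apply/eqP; rewrite (eq_coarsen QP PQ rA).
Qed.

Lemma merge_counts X Y : P != finset.set0 -> X \in parallel_classes Q -> Y \in parallel_classes Q ->
  X != Y -> P = Q :\: cross_pairs X Y ->
  nonloops P = nonloops Q /\ (#|parallel_classes P| + 1 = #|parallel_classes Q|)%N.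
Proof.
move=> P0 XC YC XY PE.
have inP i j : ([set i; j] \in P) =
    ([set i; j] \in Q) && ~~ ((i \in X) && (j \in Y) || (j \in X) && (i \in Y)).
  by rewrite PE finset.in_setD in_cross_pairs andbC.
(* A pair left in [P] has an end outside [X] and [Y]; pairs with it keep the elements of [X] and [Y]
   from becoming loops. *)
have [w wE wXY] : exists2 w, w \in nonloops Q & ~~ ((w \in X) || (w \in Y)).
  have [I IP] := finset.set0Pn _ P0.
  have := fintype.subsetP PP _ IP; rewrite /pairs inE => /cards2P[i [j [_ IE]]].
  move: IP; rewrite IE inP => /andP[ijQ nc]; have [iE jE] := nonloopsP ijQ.
  have [iXY|iXY] := boolP ((i \in X) || (i \in Y)); last by exists i.
  exists j => //; apply/norP; split; apply/negP => jXY.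
    case/orP: iXY => iXY; last by move: nc; rewrite jXY iXY orbT.
    by have := same_class_parallel QP rB XC iXY jXY; rewrite ijQ.
  case/orP: iXY => iXY; first by move: nc; rewrite jXY iXY.
  by have := same_class_parallel QP rB YC iXY jXY; rewrite ijQ.
have EE : nonloops P = nonloops Q.
  apply/eqP; rewrite finset.eqEsubset nonloops_sub //=; apply/fintype.subsetP => l lE.
  have lC := class_in lE; have ll := parallel_class_id QP lE.
  have [lXY|/norP[lX lY]] := boolP ((l \in X) || (l \in Y)).
    case/norP: (wXY) => wX wY.
    suff lw : [set l; w] \in P by have [] := nonloopsP lw.
    rewrite inP (negbTE wX) (negbTE wY) !andbF andbT.
    have wC := class_in wE; have ww := parallel_class_id QP wE.
    case/orP: lXY => lXY; [have ZC := XC | have ZC := YC].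
      apply: (distinct_classes_pair QP rB XC wC _ lXY ww).
      by apply: contraNneq wX => ->.
    apply: (distinct_classes_pair QP rB YC wC _ lXY ww).
    by apply: contraNneq wY => ->.
  have [x xX] := parallel_classes_neq0 QP XC.
  suff lx : [set l; x] \in P by have [] := nonloopsP lx.
  rewrite inP (negbTE lX) (negbTE lY) /= andbF andbT.
  apply: (distinct_classes_pair QP rB lC XC _ ll xX).
  by apply: contraNneq lX => <-.
split=> //; have surv : surviving_classes P Q = parallel_classes Q.
  by rewrite /surviving_classes EE.
have [x xX] := parallel_classes_neq0 QP XC; have [y yY] := parallel_classes_neq0 QP YC.
have [xE Xx] := parallel_classesP QP rB XC xX; have [yE Yy] := parallel_classesP QP rB YC yY.
have hXY : coarsen P X = coarsen P Y.
  apply/eqP; rewrite Xx Yy (eq_coarsen QP PQ rA) ?EE // /parallel inP xX yY.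
  by rewrite andbF.
have cE : coarsen P @: (parallel_classes Q :\ Y) = parallel_classes P.
  rewrite -(coarsen_surviving QP PQ rA) surv; apply/eqP.
  rewrite finset.eqEsubset imsetS ?finset.subD1set //=; apply/fintype.subsetP => _ /imsetP[Z ZC ->].
  have [->|ZY] := eqVneq Z Y; last by rewrite imset_f // in_setD1 ZY.
  by rewrite -hXY imset_f // in_setD1 XY.
have inj : {in parallel_classes Q :\ Y &, injective (coarsen P)}.
  move=> U V; rewrite !in_setD1 => /andP[UY UC] /andP[VY VC] /eqP hUV.
  have [u uU] := parallel_classes_neq0 QP UC; have [v vV] := parallel_classes_neq0 QP VC.
  have [uE Uu] := parallel_classesP QP rB UC uU; have [vE Vv] := parallel_classesP QP rB VC vV.
  apply/eqP; apply: contraT => UV.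
  move: hUV; rewrite Uu Vv (eq_coarsen QP PQ rA) ?EE // /parallel inP.
  rewrite (distinct_classes_pair QP rB UC VC UV uU vV) /= negbK => /orP[]/andP[] h1 h2.
    by case/eqP: VY; exact: (parallel_classes_inj QP rB VC YC vV h2).
  by case/eqP: UY; exact: (parallel_classes_inj QP rB UC YC uU h2).
by rewrite -cE (card_in_imset inj) cardsD1_in.
Qed.

Lemma delete_counts j : j \in nonloops Q -> (1 < #|parallel_class Q j|)%N ->
  P = [set I in Q | j \notin I] ->
  (#|nonloops P| + 1 = #|nonloops Q|)%N /\ #|parallel_classes P| = #|parallel_classes Q|.
Proof.
move=> jE c1 PE.
have inP k l : ([set k; l] \in P) = [&& [set k; l] \in Q, j != k & j != l].
  by rewrite PE finset.in_set in_set2 negb_or.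
(* A companion [i] of [j] replaces it in every pair, so nothing else becomes a loop and the class of
   [j] survives. *)
have [i iE [ij pij]] : exists2 i, i \in nonloops Q & i != j /\ parallel Q i j.
  have : parallel_class Q j :\ j != finset.set0.
    by rewrite -card_gt0 -(ltn_add2r 1) cardsD1_in // (parallel_class_id QP).
  case/finset.set0Pn => i; rewrite in_setD1 in_parallel_class => /and3P[ij iE pij].
  by exists i.
have EE : nonloops P = nonloops Q :\ j.
  apply/eqP; rewrite finset.eqEsubset; apply/andP; split; apply/fintype.subsetP => l.
    rewrite {1}/nonloops finset.in_set => /existsP[k]; rewrite inP in_setD1 => /and3P[lkQ jl _].
    by have [lE _] := nonloopsP lkQ; rewrite eq_sym jl.
  rewrite in_setD1 => /andP[lj lE].
  have := lE; rewrite {1}/nonloops finset.in_set => /existsP[w lwQ].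
  have [wj|wj] := eqVneq w j.
    suff li : [set l; i] \in P by have [] := nonloopsP li.
    rewrite inP [j == l]eq_sym lj [j == i]eq_sym ij !andbT.
    apply: contraLR lwQ => nli; rewrite wj.
    exact: (parallel_trans QP rB iE nli pij).
  suff lw : [set l; w] \in P by have [] := nonloopsP lw.
  by rewrite inP lwQ eq_sym lj eq_sym wj.
split; first by rewrite EE cardsD1_in.
have surv : surviving_classes P Q = parallel_classes Q.
  apply/eqP; rewrite finset.eqEsubset surviving_sub //=; apply/fintype.subsetP => _ /imsetP[l lE ->].
  have [->|lj] := eqVneq l j; last by apply: imset_f; rewrite EE in_setD1 lj.
  have /eqP <- : parallel_class Q i == parallel_class Q j by rewrite (eq_parallel_class QP rB).
  by apply: imset_f; rewrite EE in_setD1 ij.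
rewrite -(coarsen_surviving QP PQ rA) card_in_imset ?surv // -surv.
move=> _ _ /imsetP[k kE ->] /imsetP[l lE ->] /eqP; rewrite (eq_coarsen QP PQ rA) //.
move: kE lE; rewrite EE !in_setD1 => /andP[kj kE] /andP[lj lE].
rewrite /parallel inP [j == k]eq_sym kj [j == l]eq_sym lj !andbT => pkl.
by apply/eqP; rewrite (eq_parallel_class QP rB).
Qed.

End CodimensionOne.

(** * Components of the graph as parallel classes of the complement *)

Section Graph.
Variables (R : realType) (n : nat) (D : {set {set 'I_n}}) (B : 'M[R]_(2, n)).
Implicit Types (i j k l : 'I_n).
Hypothesis rB : realizes B (pairsC D).

Let QP := pairsC_sub D.

(** All pairs of an element of [full_vertices D] lie in [D], which makes it a loop of the
    complement. *)
Lemma graph_vertices_nonloops : graph_vertices D = nonloops (pairsC D).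
Proof.
apply/setP => i; rewrite finset.in_setC /full_vertices finset.in_set.
rewrite /nonloops finset.in_set negb_forall; apply: eq_existsb => j.
by rewrite negb_imply in_pairsC eq_sym.
Qed.

Lemma graph_edgeE i j : graph_edge D i j =
  [&& i \in nonloops (pairsC D), j \in nonloops (pairsC D), i != j & parallel (pairsC D) i j].
Proof.
rewrite /graph_edge /= graph_vertices_nonloops /parallel in_pairsC negb_and !negbK.
by case: eqP => //= _; rewrite !andbF.
Qed.

(** Parallelism is transitive on nonloops, so a path collapses to a single edge. *)
Lemma connect_graph_edge i j : i \in nonloops (pairsC D) -> j \in nonloops (pairsC D) ->
  connect (graph_edge D) i j = parallel (pairsC D) i j.
Proof.
move=> iE jE; apply/idP/idP => [/connectP[p + ->]|pij]; last first.
  have [->|ij] := eqVneq i j; first exact: connect0.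
  by apply: connect1; rewrite graph_edgeE iE jE ij.
elim: p i iE {jE} => [|k p IH] i iE; first by move=> _; exact: (parallel_refl QP).
move=> /andP[]; rewrite graph_edgeE => /and4P[_ kE _ ik] /(IH k kE).
exact: (parallel_trans QP rB kE ik).
Qed.

Lemma components_parallel : components D = parallel_classes (pairsC D).
Proof.
rewrite /components /equivalence_partition graph_vertices_nonloops.
apply: eq_in_imset => i iE; apply/setP => j; rewrite [LHS]finset.in_set in_parallel_class.
by have [jE|//] := boolP (j \in nonloops (pairsC D)); rewrite connect_graph_edge //= parallelC.
Qed.

End Graph.

(** * Members of the boundary and facets *)

Section Boundary.
Variables (R : realType) (n : nat) (D : {set {set 'I_n}}) (m : nat) (C : 'I_m -> {set 'I_n}).
Hypothesis pD : positroid R (pairsC D).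
Hypothesis cyc : cyclically_ordered_components D C.
Local Notation Q := (pairsC D).

Let QP := pairsC_sub D.

Lemma component_class i : C i \in parallel_classes Q.
Proof.
have /positroid_realizes[_ _ [B rB]] := pD; have [_ CE _] := cyc.
by rewrite -(components_parallel rB) -CE imset_f.
Qed.

Lemma class_component X : X \in parallel_classes Q -> exists i, X = C i.
Proof.
have /positroid_realizes[_ _ [B rB]] := pD; have [_ CE _] := cyc.
by rewrite -(components_parallel rB) -CE => /imsetP[i _ ->]; exists i.
Qed.

Lemma component_succ i : exists2 a, a \in C i &
  next (enum (nonloops Q)) a \in C (ordS i) /\
  cyclic_next (nonloops Q) a (next (enum (nonloops Q)) a).
Proof.
have /positroid_realizes[_ _ [B rB]] := pD; have [_ _ /(_ i)[a aC sC]] := cyc.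
have [aE _] := parallel_classesP QP rB (component_class i) aC.
exists a => //; split; last exact: next_enumP.
by move: sC; rewrite /cyclic_succ graph_vertices_nonloops.
Qed.

(** A single component would make all nonloops parallel and the complement empty. *)
Lemma ordS_neq i : C i != C (ordS i).
Proof.
have /positroid_realizes[_ Q0 [B rB]] := pD; have [Cinj _ _] := cyc.
apply/eqP => /Cinj e.
have m1 : (m <= 1)%N.
  have := congr1 val e; rewrite /=; have := ltn_ord i.
  rewrite leq_eqVlt => /orP[/eqP im|im]; last by rewrite modn_small //; lia.
  by rewrite -[X in (_ %% X)%N]im modnn; lia.
have [I IQ] := finset.set0Pn _ Q0.
have := fintype.subsetP QP _ IQ; rewrite /pairs inE => /cards2P[x [y [_ IE]]].
rewrite IE in IQ; have [xE yE] := nonloopsP IQ.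
have [p pE] : exists p, parallel_class Q x = C p by apply: class_component; apply/imsetP; exists x.
have [q qE] : exists q, parallel_class Q y = C q by apply: class_component; apply/imsetP; exists y.
have pq : p = q by apply/val_inj => /=; have := ltn_ord p; have := ltn_ord q; lia.
have : parallel_class Q x == parallel_class Q y by rewrite pE qE pq.
by rewrite (eq_parallel_class QP rB) // /parallel IQ.
Qed.

Lemma pairsC_cross X Y : pairsC (D :|: cross_pairs X Y) = Q :\: cross_pairs X Y.
Proof. by rewrite /pairsC finset.setDDl. Qed.

Lemma pairsC_add_full j : pairsC (add_full D j) = [set I in Q | j \notin I].
Proof.
apply: eq_pair_sets; first exact: pairsC_sub.
  by apply: fintype.subset_trans QP; apply/fintype.subsetP => I; rewrite finset.in_set => /andP[].
move=> i k ik; rewrite in_pairsC in_add_full // finset.in_set in_set2 in_pairsC ik /=.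
by rewrite !negb_or ![_ == j]eq_sym.
Qed.

Lemma boundary1P E : E \in boundary1 D C <->
  (exists i, E = D :|: cross_pairs (C i) (C (ordS i))) \/
  (exists2 j, j \in nonloops Q /\ (1 < #|parallel_class Q j|)%N & E = add_full D j).
Proof.
have /positroid_realizes[_ _ [B rB]] := pD.
rewrite /boundary1 finset.in_setU; split=> [/orP[/imsetP[i _ ->]|/imsetP[j jJ ->]]|].
- by left; exists i.
- right; exists j => //; move: jJ; rewrite /nonsingleton_vertices finset.in_set.
  case/andP=> _ /existsP[i /andP[jC c1]].
  by have [jE <-] := parallel_classesP QP rB (component_class i) jC.
case=> [[i ->]|[j [jE c1] ->]]; apply/orP; [left|right].
  by apply/imsetP; exists i.
apply/imsetP; exists j => //; rewrite /nonsingleton_vertices finset.in_set graph_vertices_nonloops jE /=.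
have [i iE] : exists i, parallel_class Q j = C i by apply: class_component; apply/imsetP; exists j.
by apply/existsP; exists i; rewrite -iE c1 (parallel_class_id QP).
Qed.

Lemma merged_adjacent P p q : positroid R P -> nonloops P = nonloops Q -> C p != C q ->
  P = Q :\: cross_pairs (C p) (C q) -> q = ordS p \/ p = ordS q.
Proof.
move=> pP EE Cpq PE; have /positroid_realizes[_ _ [B rB]] := pD.
have /positroid_realizes[PP _ [A rA]] := pP; have [Cinj _ _] := cyc.
have [->|qp] := eqVneq q (ordS p); first by left.
have [->|pq] := eqVneq p (ordS q); first by right.
(* If the components are not adjacent, the successors [b] and [d] lie outside both, which is the
   configuration that [no_crossing] excludes. *)
exfalso; have [a aC [bC ab]] := component_succ p; have [c cC [dC cd]] := component_succ q.
move: (next _ a) (next _ c) bC dC ab cd => b d bC dC ab cd.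
have Cin := component_class.
have inP i j : ([set i; j] \in P) =
    ([set i; j] \in Q) && ~~ ((i \in C p) && (j \in C q) || (j \in C p) && (i \in C q)).
  by rewrite PE finset.in_setD in_cross_pairs andbC.
have disj i j k : C i != C j -> k \in C i -> k \notin C j.
  move=> ij ki; apply/negP => kj; case/eqP: ij.
  exact: (parallel_classes_inj QP rB (Cin i) (Cin j) ki kj).
have CneqI i j : i != j -> C i != C j by apply: contra_neq => /Cinj.
have qp' : C (ordS p) != C q by apply: CneqI; rewrite eq_sym.
have pq' : C (ordS q) != C p by apply: CneqI; rewrite eq_sym.
have Sp : C (ordS p) != C p by rewrite eq_sym ordS_neq.
have Sq : C (ordS q) != C q by rewrite eq_sym ordS_neq.
have bp := disj _ _ _ Sp bC; have bq := disj _ _ _ qp' bC.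
have dp := disj _ _ _ pq' dC; have dq := disj _ _ _ Sq dC.
have pr i j k l : C i != C j -> k \in C i -> l \in C j -> [set k; l] \in Q.
  by move=> ij; exact: (distinct_classes_pair QP rB (Cin i) (Cin j) ij).
have [aE _] := parallel_classesP QP rB (Cin p) aC.
have [cE _] := parallel_classesP QP rB (Cin q) cC.
apply: (no_crossing PP rA EE _ _ _ ab cd).
- by rewrite EE.
- by rewrite EE.
- by apply: contraTneq aC => ->; apply: disj cC; rewrite eq_sym.
- by rewrite /parallel inP aC cC andbF.
- by rewrite inP (negbTE bp) (negbTE bq) andbF andbT (pr p (ordS p)) // ordS_neq.
- by rewrite inP (negbTE bp) (negbTE bq) andbF andbT (pr q (ordS p)) // eq_sym.
- by rewrite inP (negbTE dp) (negbTE dq) andbF andbT (pr p (ordS q)) // eq_sym.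
- by rewrite inP (negbTE dp) (negbTE dq) andbF andbT (pr q (ordS q)) // ordS_neq.
Qed.

Lemma boundary_facet P : P != finset.set0 -> positroid R P -> P \proper Q ->
  (positroid_dim R P + 1)%N = positroid_dim R Q ->
  exists2 E, E \in boundary1 D C & P = pairsC E.
Proof.
move=> P0 pP PQ dPQ; have /positroid_realizes[_ Q0 [B rB]] := pD.
have /positroid_realizes[PP _ [A rA]] := pP.
have sPQ := proper_sub PQ.
have dP := positroid_dimE PP P0 (ex_intro _ A rA).
have dQ := positroid_dimE QP Q0 (ex_intro _ B rB).
have k1 := subset_leq_card (nonloops_sub sPQ).
have c1 := leq_trans (card_parallel_classes_le QP sPQ rA) (subset_leq_card (surviving_sub sPQ)).
(* Neither count can grow and their sum drops by one, so exactly one of them drops. *)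
have [kk|kk] : #|nonloops P| = #|nonloops Q| \/ (#|nonloops P| < #|nonloops Q|)%N.
  by move: k1; rewrite leq_eqVlt => /orP[/eqP|]; [left|right].
- have EE : nonloops P = nonloops Q.
    by apply/eqP; rewrite eqEcard nonloops_sub //= kk.
  have cc : (#|parallel_classes P| + 1 = #|parallel_classes Q|)%N by lia.
  have [X [Y [XC YC XY PE]]] := merged_pair QP sPQ rA rB EE cc.
  have [p pE] := class_component XC; have [q qE] := class_component YC; subst X Y.
  case: (merged_adjacent pP EE XY PE) => e.
    exists (D :|: cross_pairs (C p) (C q)); last by rewrite pairsC_cross.
    by apply/boundary1P; left; exists p; rewrite -e.
  exists (D :|: cross_pairs (C q) (C p)).
    by apply/boundary1P; left; exists q; rewrite -e.
  rewrite pairsC_cross PE; congr (_ :\: _).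
  apply/setP => I; apply/imset2P/imset2P => -[x y xX yY ->];
    by exists y x => //; rewrite finset.setUC.
- have kk' : (#|nonloops P| + 1 = #|nonloops Q|)%N by lia.
  have cc : #|parallel_classes P| = #|parallel_classes Q| by lia.
  have [j [jE j1 PE]] := deleted_element QP sPQ rA rB kk' cc.
  exists (add_full D j); last by rewrite pairsC_add_full.
  by apply/boundary1P; right; exists j.
Qed.

Lemma facet_boundary E : E \in boundary1 D C -> pairsC E != finset.set0 ->
  [/\ positroid R (pairsC E), pairsC E \proper Q &
      (positroid_dim R (pairsC E) + 1)%N = positroid_dim R Q].
Proof.
move=> + P0; have /positroid_realizes[_ Q0 [B rB]] := pD.
have PP := pairsC_sub E.
have dQ := positroid_dimE QP Q0 (ex_intro _ B rB).
have fin (A : 'M[R]_(2, n)) : realizes A (pairsC E) -> pairsC E \subset Q -> pairsC E != Q ->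
    (#|nonloops (pairsC E)| + #|parallel_classes (pairsC E)| + 1 =
     #|nonloops Q| + #|parallel_classes Q|)%N ->
    [/\ positroid R (pairsC E), pairsC E \proper Q &
      (positroid_dim R (pairsC E) + 1)%N = positroid_dim R Q].
  move=> rA sub ne cnt; split.
  - by apply/positroid_realizes; split=> //; exists A.
  - by rewrite finset.properEneq ne.
  - by have := positroid_dimE PP P0 (ex_intro _ A rA); lia.
move=> /boundary1P[[p EE]|[j [jE j1] EE]].
- have PE : pairsC E = Q :\: cross_pairs (C p) (C (ordS p)) by rewrite EE pairsC_cross.
  have [a aC [bC ab]] := component_succ p; move: (next _ a) bC ab => b bC ab.
  have pC := component_class p; have sC := component_class (ordS p); have ne := ordS_neq p.
  have [aE aX] := parallel_classesP QP rB pC aC; have [bE bY] := parallel_classesP QP rB sC bC.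
  have abQ := distinct_classes_pair QP rB pC sC ne aC bC.
  have [A rA] := merge_realizable QP rB aE ab abQ; rewrite -aX -bY -PE in rA.
  have sub : pairsC E \subset Q by rewrite PE finset.subsetDl.
  have [k c] := merge_counts QP sub rA rB P0 pC sC ne PE.
  apply: (fin A) => //; last by rewrite k; lia.
  apply/eqP => e; move: abQ; rewrite -e PE finset.in_setD in_cross_pairs aC bC //.
- have PE : pairsC E = [set I in Q | j \notin I] by rewrite EE pairsC_add_full.
  have rA := delete_realizable j rB; rewrite -PE in rA.
  have sub : pairsC E \subset Q.
    by rewrite PE; apply/fintype.subsetP => I; rewrite finset.in_set => /andP[].
  have [k c] := delete_counts QP sub rA rB jE j1 PE.
  apply: fin rA sub _ _; last by lia.
  apply/eqP => e; move: k; rewrite e; lia.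
Qed.

End Boundary.

Theorem proposition4p6 (R : realType) (n : nat) (D : {set {set 'I_n}})
    (m : nat) (C : 'I_m -> {set 'I_n}) :
  (2 <= n)%N ->
  D \subset pairs n ->
  pairsC D != finset.set0 ->
  positroid R (pairsC D) ->
  cyclically_ordered_components D C ->
  [set P : {set {set 'I_n}} |
    [/\ P != finset.set0, positroid R P, P \proper pairsC D
      & (positroid_dim R P + 1)%N = positroid_dim R (pairsC D)]]%classic =
  [set P : {set {set 'I_n}} |
    P != finset.set0 /\ exists2 E, E \in boundary1 D C & P = pairsC E]%classic.
Proof.
move=> _ _ _ pD cyc; apply/seteqP; split=> P /= [P0].
  by move=> pP PQ dPQ; split=> //; exact: (boundary_facet pD cyc P0 pP PQ dPQ).
case=> E EB PE; rewrite PE in P0 *; have [pP PQ dPQ] := facet_boundary pD cyc EB P0.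
by split.
Qed.
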